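(* Let $D \subset \mathbb{C}$ be a domain that is Carathéodory hyperbolic, with Carathéodory distance $c_D$. Let $p\in D$ and $r>0$, and let $B(p,r)=\{q\in D: c_D(p,q)<r\}$. Then every connected component of $B(p,r)$ that is relatively compact in $D$ is a finitely-connected domain.
   Context: Let $\mathbb{D}$ be the open unit disk in $\mathbb{C}$ and let $\rho$ be the Poincaré distance on $\mathbb{D}$, $\rho(z,w) = \frac12\log\frac{1+t}{1-t}$ with $t = \left|\frac{z-w}{1-z\overline{w}}\right|$. Carathéodory pseudodistance: for a domain (nonempty connected open set) $D\subset\mathbb{C}$ and $p,q\in D$, $c_D(p,q)=\sup_{f}\rho(f(p),f(q))$, the supremum being over all holomorphic maps $f:D\to\mathbb{D}$. $D$ is called Carathéodory hyperbolic (C-hyperbolic) if $c_D$ is a distance, i.e. $c_D(p,q)>0$ whenever $p\ne q$. A domain $G\subset\mathbb{C}$ is $n$-connected if $\hat{\mathbb{C}}\setminus G$ has $n+1$ connected components, where $\hat{\mathbb{C}}$ is the extended complex plane; it is finitely-connected if it is $n$-connected for some non-negative integer $n$. *)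

(* Defs.v *)
From HB Require Import structures.
From mathcomp Require Import all_boot all_order all_algebra.
From mathcomp Require Import all_classical all_reals all_analysis.
From mathcomp Require Import complex.

Set Implicit Arguments.
Unset Strict Implicit.
Unset Printing Implicit Defensive.
Import Order.TTheory GRing.Theory Num.Theory.
Import numFieldNormedType.Exports.

Local Open Scope classical_set_scope.
Local Open Scope ring_scope.

(* Bundled as a [numClosedFieldType], the complex numbers inherit the topology
   and the structure of normed module over themselves that every numeric field
   carries, so that [derivable] below is differentiability over the complex
   numbers. *)
Definition Cplx (R : realType) : numClosedFieldType := R[i].

(* The norm of [Cplx R] takes its values in [Cplx R]; [Normc.normc] is the same
   norm with values in [R]. *)
Definition poincare_dist (R : realType) (z w : Cplx R) : R :=
  let t := Normc.normc ((z - w) / (1 - z * w^* )) in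
  2^-1 * ln ((1 + t) / (1 - t)).

Definition is_domain (R : realType) (D : set (Cplx R)) : Prop :=
  [/\ open D, connected D & D !=set0].

(* Holomorphic maps from [D] to the open unit disk; the values of [f] outside
   the open set [D] are irrelevant. *)
Definition holo_to_disk (R : realType) (D : set (Cplx R))
    : set (Cplx R -> Cplx R) :=
  [set f | forall z, D z -> derivable f z 1 /\ `|f z| < 1].

(* The supremum is taken in the extended reals, so that no finiteness is
   presupposed. *)
Definition caratheodory (R : realType) (D : set (Cplx R)) (p q : Cplx R)
    : \bar R :=
  ereal_sup [set (poincare_dist (f p) (f q))%:E | f in holo_to_disk D].

Definition C_hyperbolic (R : realType) (D : set (Cplx R)) : Prop :=
  forall p q, D p -> D q -> p <> q -> (0 < caratheodory D p q)%E.

Definition caratheodory_ball (R : realType) (D : set (Cplx R)) (p : Cplx R)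
    (r : R) : set (Cplx R) :=
  [set q | D q /\ (caratheodory D p q < r%:E)%E].

Definition components (T : topologicalType) (A : set T) : set (set T) :=
  [set connected_component A x | x in A].

Definition relatively_compact_in (T : topologicalType) (D U : set T) : Prop :=
  compact (closure U) /\ closure U `<=` D.

(* The extended complex plane, with [None] as the point at infinity. *)
Definition riemann_sphere (R : realType) : topologicalType :=
  one_point_compactification (Cplx R).

Definition n_connected (R : realType) (n : nat) (G : set (Cplx R)) : Prop :=
  (components (~` ((Some : Cplx R -> riemann_sphere R) @` G)) #= `I_n.+1)%card.

Definition finitely_connected (R : realType) (G : set (Cplx R)) : Prop :=
  exists n, n_connected n G.

(* Main.v *)
Require Import Defs.
From mathcomp Require Import all_boot all_order all_algebra.
From mathcomp Require Import all_classical all_reals all_analysis.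
From mathcomp Require Import complex.
From mathcomp Require Import ring lra.
Import Order.TTheory GRing.Theory Num.Theory.
Import numFieldNormedType.Exports.
Local Open Scope classical_set_scope.
Local Open Scope ring_scope.
Set Implicit Arguments.
Unset Strict Implicit.
Unset Printing Implicit Defensive.

(** Put [s = tanh r], and let [m q] be the supremum of [|g q|] over the
    holomorphic maps [g] from [D] to the unit disk with [g p = 0].  A Moebius
    change of the target turns the ball into the sublevel set [m < s].  Call a
    holomorphic function dominated if it vanishes at [p] and has modulus at most
    [m] on [D].  The dominated functions form a compact family, so that for each
    [q] some dominated [f] is extremal: [|f q| = m q].

    Let [U] be a relatively compact component of the ball.  It is open because
    [m] is locally Lipschitz, [m < s] on [U], and [m = s] on the boundary of [U].
    So a connected subset of [D] on which one dominated function has modulus at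
    least [s] avoids [U], and lies in a single component of the complement of
    [U] in the sphere.  Every component of the complement that avoids infinity
    contains a boundary point of [U].

    Suppose that infinitely many distinct components [K_j] avoid infinity, and
    take boundary points [x_j] of [U] in [K_j], with [f_j] extremal at [x_j].
    Along an ultrafilter, [x_j] tends to some [x] of the compact boundary of [U],
    and [f_j] to a dominated [f] with [|f x| >= s].  As [f p = 0], [f] is not
    constant near [x] (identity theorem), so the critical points of [f] are
    isolated near [x], and some small circle about [x], of radius [eps], carries
    none ([isolated_critical]).

    The maximum of [|f_j|] over the points of [K_j] at distance at most [eps] from
    [x_j] is attained at distance exactly [eps]: from any other point there starts
    a segment along which [|f_j|] increases, and such a segment stays in [K_j]
    ([component_reaches_circle]).  This gives [y_j] in [K_j] with
    [|y_j - x_j| = eps] and [|f_j y_j| >= s]; let [y] be the limit of the [y_j].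
    As [f' y <> 0], moving from [y_j] in the direction [v = f y / f' y] increases
    [|f_j|] at a rate that does not depend on [j], so the segment from [y_j] to
    [y_j + delta v], followed by the one to [y + delta v], stays in [K_j]
    ([component_ascent]).  Hence almost all the [K_j] contain the same point
    [y + delta v], although they are pairwise disjoint.

    The function theory starts from differentiability at each point.  Goursat's
    argument, for the integrals along the sides of a square in parameter space,
    yields Cauchy's formula on circles, hence the Taylor expansion with a
    remainder that depends on a bound for the function only ([taylor]).  Its
    second-order case passes to pointwise limits, which gives the compactness of
    the dominated functions; its general case gives the local behaviour of a
    function at a point of finite order. *)

(** * Modulus and topology of the complex plane *)

(** The order on complex numbers is partial, so all estimates are made with this
    real-valued modulus instead of the norm of [Cplx R]. *)
Definition cabs (R : realType) (z : Cplx R) : R := Normc.normc z.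
Definition cofr (R : realType) (a : R) : Cplx R := (a%:C)%C.

Section basics.
Context {R : realType}.
Implicit Types (z w : Cplx R) (a b : R).

Lemma cabsE z : `|z| = cofr (cabs z).
Proof. by []. Qed.
Lemma cabsM z w : cabs (z * w) = cabs z * cabs w.
Proof. exact: Normc.normcM. Qed.
Lemma cabsD z w : cabs (z + w) <= cabs z + cabs w.
Proof. exact: le_normcD. Qed.
Lemma cabsN z : cabs (- z) = cabs z.
Proof. exact: normcN. Qed.
Lemma cabsV z : cabs (z^-1) = (cabs z)^-1.
Proof. exact: Normc.normcV. Qed.
Lemma cabs0 : cabs (0 : Cplx R) = 0.
Proof. exact: Normc.normc0. Qed.
Lemma cabs1 : cabs (1 : Cplx R) = 1.
Proof. exact: Normc.normc1. Qed.
Lemma cabs_ge0 z : 0 <= cabs z.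
Proof. by case: z => x y; exact: sqrtr_ge0. Qed.
Lemma cabs_eq0 z : (cabs z == 0) = (z == 0).
Proof. by apply/eqP/eqP => [/Normc.eq0_normc//|->]; exact: cabs0. Qed.
Lemma cofrM a b : cofr (a * b) = cofr a * cofr b.
Proof. exact: rmorphM. Qed.
Lemma cofrD a b : cofr (a + b) = cofr a + cofr b.
Proof. exact: rmorphD. Qed.
Lemma cabs_cofr a : cabs (cofr a) = `|a|.
Proof. by rewrite /cabs /= expr0n /= addr0 sqrtr_sqr. Qed.

Lemma nbhs_cabs z (A : set (Cplx R)) : nbhs z A <->
  exists2 e : R, 0 < e & forall w, cabs (w - z) < e -> A w.
Proof.
split.
  move=> /nbhs_normP [e /= e0 eA]; exists (complex.Re e).
    by move: e0; rewrite ltcE => /andP[].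
  move=> w we; apply: eA => /=.
  move: e0; rewrite ltcE /= => /andP [/eqP ie _].
  by rewrite distrC cabsE ltcE /= ie eqxx.
case=> e e0 eA; apply/nbhs_normP; exists (cofr e) => /=.
  by rewrite ltcE /= eqxx.
move=> w /=; rewrite distrC cabsE ltcE /= => /andP [_ ?]; exact: eA.
Qed.

Lemma cabs_gt0 z : (0 < cabs z) = (z != 0).
Proof. by rewrite lt_neqAle eq_sym cabs_eq0 cabs_ge0 andbT. Qed.

Lemma cabsX z n : cabs (z ^+ n) = cabs z ^+ n.
Proof. by elim: n => [|n IH]; rewrite ?expr0 ?cabs1 // !exprS cabsM IH. Qed.

Lemma cdistrC z w : cabs (z - w) = cabs (w - z).
Proof. by rewrite -cabsN opprB. Qed.

Lemma cabsB z w : cabs z - cabs w <= cabs (z - w).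
Proof. by rewrite lerBlDr; have := cabsD (z - w) w; rewrite subrK. Qed.

Lemma cabs_tri (x z w : Cplx R) : cabs (z - w) <= cabs (z - x) + cabs (x - w).
Proof. by have := cabsD (z - x) (x - w); rewrite addrA subrK. Qed.

Lemma open_cabs (A : set (Cplx R)) : open A <-> forall z, A z ->
  exists2 e : R, 0 < e & forall w, cabs (w - z) < e -> A w.
Proof.
rewrite openE; split=> h z Az; first by have /nbhs_cabs := h z Az.
by apply/nbhs_cabs; exact: h.
Qed.

Lemma closure_cabs (A : set (Cplx R)) z : closure A z <->
  forall e : R, 0 < e -> exists2 w, A w & cabs (w - z) < e.
Proof.
split=> [cA e e0|h B /nbhs_cabs [e e0 eB]].
  have [w [Aw we]] : A `&` [set w | cabs (w - z) < e] !=set0.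
    by apply: cA; apply/nbhs_cabs; exists e.
  by exists w.
by have [w Aw we] := h e e0; exists w; split=> //; exact: eB.
Qed.

Lemma ReB z w : complex.Re (z - w) = complex.Re z - complex.Re w.
Proof. by case: z; case: w. Qed.
Lemma ImB z w : complex.Im (z - w) = complex.Im z - complex.Im w.
Proof. by case: z; case: w. Qed.
Lemma ReD z w : complex.Re (z + w) = complex.Re z + complex.Re w.
Proof. by case: z; case: w. Qed.
Lemma ImD z w : complex.Im (z + w) = complex.Im z + complex.Im w.
Proof. by case: z; case: w. Qed.
Lemma ReM z w : complex.Re (z * w) =
  complex.Re z * complex.Re w - complex.Im z * complex.Im w.
Proof. by case: z; case: w. Qed.
Lemma ImM z w : complex.Im (z * w) =
  complex.Re z * complex.Im w + complex.Im z * complex.Re w.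
Proof. by case: z; case: w. Qed.

Lemma cplx_eq (z w : Cplx R) : complex.Re z = complex.Re w ->
  complex.Im z = complex.Im w -> z = w.
Proof. by case: z; case: w => a b c d /= -> ->. Qed.

Lemma cabs_le_ReIm z : cabs z <= `|complex.Re z| + `|complex.Im z|.
Proof.
case: z => a b /=; have E : cofr a + Complex 0 b = Complex a b :> Cplx R.
  by apply/eqP; rewrite eq_complex /= addr0 add0r !eqxx.
have := cabsD (cofr a) (Complex 0 b); rewrite E cabs_cofr => /le_trans; apply.
by rewrite lerD2l /cabs /= expr0n add0r sqrtr_sqr.
Qed.

Lemma Re_le_cabs z : `|complex.Re z| <= cabs z.
Proof.
case: z => a b; rewrite /cabs /= -sqrtr_sqr ler_wsqrtr // lerDl; exact: sqr_ge0.
Qed.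

Lemma Im_le_cabs z : `|complex.Im z| <= cabs z.
Proof.
case: z => a b; rewrite /cabs /= -sqrtr_sqr ler_wsqrtr // lerDr; exact: sqr_ge0.
Qed.

Lemma closed_cdisc z a : closed [set w | cabs (w - z) <= a].
Proof.
apply/closure_id; rewrite eqEsubset; split; first exact: subset_closure.
move=> w /closure_cabs h /=; apply/ler_addgt0Pr => e e0.
have [v /= va vw] := h e e0; apply: le_trans (cabs_tri v _ _) _.
by rewrite addrC lerD // cdistrC ltW.
Qed.

(** The disc is a closed subset of the image of a square of real pairs. *)
Lemma compact_cdisc z a : compact [set w | cabs (w - z) <= a].
Proof.
pose f (u : R * R) : Cplx R := Complex u.1 u.2.
have fc : continuous f.
  move=> [u v] A /nbhs_cabs [e e0 eA].
  have e2 : 0 < e / 2 by rewrite divr_gt0.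
  exists (ball u (e / 2), ball v (e / 2)) => /=.
    by split; exact: nbhsx_ballx.
  move=> [u' v'] [/= h1 h2]; apply: eA; apply: le_lt_trans (cabs_le_ReIm _) _.
  move: h1 h2; rewrite /ball /= /f /= => h1 h2.
  by rewrite distrC (distrC v') (splitr e) ltrD.
pose B := `[complex.Re z - a, complex.Re z + a]%classic `*`
          `[complex.Im z - a, complex.Im z + a]%classic.
have cB : compact (f @` B).
  apply: continuous_compact; first exact: continuous_subspaceT.
  by apply: compact_setX; exact: segment_compact.
apply: (@subclosed_compact _ _ (f @` B)) => //; first exact: closed_cdisc.
move=> w /= wz.
exists (complex.Re w, complex.Im w); last by case: w {wz}.
have hr := le_trans (Re_le_cabs _) wz; have hi := le_trans (Im_le_cabs _) wz.
move: hr hi; rewrite ReB ImB => /ler_normlP [h1 h2] /ler_normlP [h3 h4].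
by split => /=; rewrite in_itv /=; apply/andP; split; lra.
Qed.

Lemma csegment_connected z w :
  connected [set z + cofr t * w | t in `[0, 1]%classic].
Proof.
apply: connected_continuous_connected; first exact: segment_connected.
apply: continuous_subspaceT => t A /nbhs_cabs [e e0 eA].
have c0 : 0 < cabs w + 1 by rewrite ltr_wpDl ?cabs_ge0.
have := nbhsx_ballx t (e / (cabs w + 1)) (divr_gt0 e0 c0).
apply: filterS => u; rewrite /ball /= => tu; apply: eA.
have -> : z + cofr u * w - (z + cofr t * w) = cofr (u - t) * w.
  by rewrite cofrD /cofr rmorphN /=; ring.
rewrite cabsM cabs_cofr distrC.
have /le_lt_trans : `|t - u| * cabs w <= `|t - u| * (cabs w + 1).
  by rewrite ler_wpM2l // lerDl.
by apply; rewrite -ltr_pdivlMr.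
Qed.

(** A disc is a union of radii, which all contain its centre. *)
Lemma cball_connected z (e : R) : connected [set w | cabs (w - z) < e].
Proof.
have [e0|/ltW e0] := leP e 0.
  have -> : [set w | cabs (w - z) < e] = set0; last exact: connected0.
  by rewrite -subset0 => w /= /lt_le_trans /(_ e0); rewrite ltNge cabs_ge0.
have [->|e1] := eqVneq e 0.
  have -> : [set w | cabs (w - z) < 0] = set0; last exact: connected0.
  by rewrite -subset0 => w /=; rewrite ltNge cabs_ge0.
have -> : [set w | cabs (w - z) < e] =
   \bigcup_(h in [set h | cabs h < e]) [set z + cofr t * h | t in `[0, 1]%classic].
  rewrite eqEsubset; split.
    move=> w /= we; exists (w - z) => //; exists 1; first by rewrite /= in_itv /= ler01 lexx.
    by rewrite /cofr rmorph1 mul1r addrC subrK.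
  move=> w [h /= he [t]]; rewrite /= in_itv /= => /andP [t0 t1] <-.
  rewrite addrC addKr cabsM cabs_cofr ger0_norm //.
  by apply: le_lt_trans he; rewrite ler_piMl ?cabs_ge0.
apply: bigcup_connected.
  exists z => h _; exists 0; first by rewrite /= in_itv /= ler01 lexx.
  by rewrite /cofr rmorph0 mul0r addr0.
by move=> h _; exact: csegment_connected.
Qed.

End basics.

(** Complex differentiability as an estimate between real numbers; it agrees with
    [is_derive] by [has_cderivP]. *)
Definition has_cderiv (R : realType) (f : Cplx R -> Cplx R) (z l : Cplx R) :=
  forall e : R, 0 < e -> exists2 d : R, 0 < d &
    forall w, cabs (w - z) < d -> cabs (f w - f z - l * (w - z)) <= e * cabs (w - z).

Section complex_derivative.
Context {R : realType}.
Implicit Types (f : Cplx R -> Cplx R) (x z w l : Cplx R).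

Lemma has_cderivP f z l : has_cderiv f z l <-> is_derive z 1 f l.
Proof.
split=> [fl|[dfz <-]].
  have h : h^-1 *: (f (h *: 1 + z) - f z) @[h --> 0^'] --> l.
    move=> A /nbhs_cabs [e e0 eA]; have [|d d0 dP] := fl (e / 2); first by rewrite divr_gt0.
    rewrite /nbhs /=; apply/nbhs_cabs; exists d => // h; rewrite subr0 => hd h0.
    apply: eA; rewrite /GRing.scale /= mulr1.
    have := dP (h + z); rewrite addrK => /(_ hd) hh.
    have h0' : 0 < cabs h by rewrite cabs_gt0.
    have -> : h^-1 * (f (h + z) - f z) - l = (f (h + z) - f z - l * h) / h by field.
    rewrite cabsM cabsV ltr_pdivrMr //; apply: le_lt_trans hh _.
    by rewrite ltr_pM2r // ltr_pdivrMr // mulr_natr mulr2n ltrDl.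
  by apply: DeriveDef; [apply/cvg_ex; exists l | apply: cvg_lim => //; exact: norm_hausdorff].
move=> e e0.
have : nbhs ('D_1 f z) [set w | cabs (w - 'D_1 f z) < e] by apply/nbhs_cabs; exists e.
move=> /dfz; rewrite /nbhs /= => /nbhs_cabs [d d0 dP].
exists d => // w wz; have [->|wz0] := eqVneq w z.
  by rewrite !subrr mulr0 subr0 cabs0 mulr0.
have /= := dP (w - z); rewrite subr0 => /(_ wz).
rewrite subr_eq0 => /(_ wz0); rewrite /GRing.scale /= mulr1 subrK => h.
have -> : f w - f z - 'D_1 f z * (w - z) = ((w - z)^-1 * (f w - f z) - 'D_1 f z) * (w - z).
  by field; rewrite subr_eq0.
by rewrite cabsM ler_wpM2r ?cabs_ge0 // ltW.
Qed.

Lemma has_cderiv_unique f z l l' : has_cderiv f z l -> has_cderiv f z l' -> l = l'.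
Proof. by move=> /has_cderivP [_ <-] /has_cderivP [_ <-]. Qed.

Lemma derivable_cderiv f z : derivable f z 1 <-> exists l, has_cderiv f z l.
Proof.
split=> [fz|[l /has_cderivP []//]].
by exists ('D_1 f z); apply/has_cderivP; exact: derivableP.
Qed.

(** Unlike the definition of the derivative, this bound involves constants that
    can be uniform in a family, so it survives a pointwise limit. *)
Lemma has_cderiv_quadratic f x d (r K : R) : 0 < r -> 0 <= K ->
  (forall z, cabs (z - x) <= r -> cabs (f z - f x - d * (z - x)) <= K * cabs (z - x) ^+ 2) ->
  has_cderiv f x d.
Proof.
move=> r0 K0 h e e0; have K1 : 0 < K + 1 by lra.
exists (Num.min r (e / (K + 1))); first by rewrite lt_min r0 divr_gt0.
move=> z; rewrite lt_min => /andP [/ltW z1]; rewrite ltr_pdivlMr // => z2.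
apply: le_trans (h z z1) _; rewrite expr2 mulrA ler_wpM2r ?cabs_ge0 //.
by have := cabs_ge0 (z - x); lra.
Qed.

Lemma has_cderiv_continuous f z l : has_cderiv f z l ->
  forall e : R, 0 < e -> exists2 d : R, 0 < d &
    forall w, cabs (w - z) < d -> cabs (f w - f z) < e.
Proof.
move=> df e e0; have [d d0 dP] := df 1 ltr01.
have L0 : 0 < cabs l + 1 by rewrite ltr_wpDl ?cabs_ge0.
exists (Num.min d (e / (cabs l + 1))); first by rewrite lt_min d0 divr_gt0.
move=> w; rewrite lt_min ltr_pdivlMr // => /andP [/dP h1 h2].
apply: le_lt_trans h2; have -> : f w - f z = (f w - f z - l * (w - z)) + l * (w - z) by ring.
by apply: le_trans (cabsD _ _) _; rewrite cabsM; lra.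
Qed.

End complex_derivative.

(** * Dyadic subdivision of squares *)
Section dyadic.
Context {R : realType}.

Lemma exists_half_pow_lt (l d : R) : 0 < d -> exists n, l / 2 ^+ n < d.
Proof.
move=> d0; exists (Num.bound (l / d)).
by rewrite ltr_pdivrMr ?exprn_gt0 // mulrC -ltr_pdivrMr // upper_nthrootP.
Qed.

(** If the property failed for some square, it would fail for nested squares of
    sides tending to 0, and then near their common point.  In Goursat's argument
    this replaces the choice of a subdivision adapted to the derivative. *)
Lemma dyadic_induction (P : R -> R -> R -> Prop) :
  (forall u t l, P u t (l / 2) -> P (u + l / 2) t (l / 2) ->
     P u (t + l / 2) (l / 2) -> P (u + l / 2) (t + l / 2) (l / 2) -> P u t l) ->
  (forall u0 t0, 0 <= u0 -> 0 <= t0 -> exists2 d, 0 < d &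
     forall u t l, 0 <= u -> 0 <= t -> 0 < l -> l < d ->
       u <= u0 <= u + l -> t <= t0 <= t + l -> P u t l) ->
  forall u t l, 0 <= u -> 0 <= t -> 0 < l -> P u t l.
Proof.
move=> Psub Ploc u t l u0 t0 l0; apply: contrapT => nP.
(* A square is encoded as ((left, bottom), side). *)
have step (q : R * R * R) : exists q' : R * R * R, 0 <= q.2 ->
   [/\ q'.2 = q.2 / 2, q.1.1 <= q'.1.1 <= q.1.1 + q.2 / 2,
       q.1.2 <= q'.1.2 <= q.1.2 + q.2 / 2 &
       ~ P q.1.1 q.1.2 q.2 -> ~ P q'.1.1 q'.1.2 q'.2].
  case: q => [[a b] c] /=; have [c0|c0] := ltP c 0; first by exists (a, b, c).
  have c2 : 0 <= c / 2 by rewrite divr_ge0.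
  have [h|h] := pselect (P a b c).
    by exists (a, b, c / 2) => _; split=> //=; rewrite lexx lerDl.
  have : ~ (P a b (c / 2) /\ P (a + c / 2) b (c / 2) /\
     P a (b + c / 2) (c / 2) /\ P (a + c / 2) (b + c / 2) (c / 2)).
    by case=> h1 [h2 [h3 h4]]; apply: h; exact: Psub.
  move=> /not_andP [|/not_andP [|/not_andP []]] ?.
  - by exists (a, b, c / 2) => _; split=> //=; rewrite ?lexx ?lerDl.
  - by exists (a + c / 2, b, c / 2) => _; split=> //=; rewrite ?lexx ?lerDl ?c2.
  - by exists (a, b + c / 2, c / 2) => _; split=> //=; rewrite ?lexx ?lerDl ?c2.
  - by exists (a + c / 2, b + c / 2, c / 2) => _; split=> //=; rewrite ?lexx ?lerDl ?c2.
have [nxt nxtP'] := choice step.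
pose q n := iter n nxt (u, t, l).
have ql n : (q n).2 = l / 2 ^+ n.
  elim: n => [|n IH]; first by rewrite expr0 divr1.
  have [|-> _ _ _] := nxtP' (q n); last by rewrite IH exprSr invfM mulrA.
  by rewrite IH divr_ge0 ?exprn_ge0 // ltW.
have ql0 n : 0 < (q n).2 by rewrite ql divr_gt0 // exprn_gt0.
have nxtP n := nxtP' (q n) (ltW (ql0 n)).
have qP n : ~ P (q n).1.1 (q n).1.2 (q n).2.
  by elim: n => // n IH; have [_ _ _] := nxtP n; apply.
have nest (f : R * R * R -> R) :
    (forall n, f (q n) <= f (q n.+1) <= f (q n) + (q n).2 / 2) ->
    exists x, forall n, f (q n) <= x <= f (q n) + (q n).2.
  move=> h.
  have up m n : f (q n) <= f (q (n + m)%N).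
    elim: m => [|m IH]; first by rewrite addn0.
    by rewrite addnS; apply: le_trans IH _; case/andP: (h (n + m)%N).
  have dn m n : f (q (n + m)%N) + (q (n + m)%N).2 <= f (q n) + (q n).2.
    elim: m => [|m IH]; first by rewrite addn0.
    rewrite addnS; apply: le_trans IH; case/andP: (h (n + m)%N) => _ h2.
    have [-> _ _ _] : _ := nxtP (n + m)%N.
    by rewrite -[q _]/(q (n + m).+1); lra.
  have ub n m : f (q m) <= f (q n) + (q n).2.
    have [mn|/ltnW nm] := leqP m n.
      by apply: le_trans (_ : f (q m) <= f (q n)) _;
        [rewrite -(subnKC mn) up | rewrite lerDl ltW].
    by apply: le_trans (_ : _ <= f (q m) + (q m).2) _;
      [rewrite lerDl ltW | rewrite -(subnKC nm) dn].
  exists (sup (range (fun n => f (q n)))) => n; apply/andP; split.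
    apply: ub_le_sup; last by exists n.
    by exists (f (q 0%N) + (q 0%N).2) => _ [m _ <-].
  by apply: ge_sup; [exists (f (q 0%N)), 0%N | move=> _ [m _ <-]].
have [x xP] : exists x, forall n, (q n).1.1 <= x <= (q n).1.1 + (q n).2.
  by apply: (nest (fun q => q.1.1)) => n; have [_] := nxtP n.
have [y yP] : exists y, forall n, (q n).1.2 <= y <= (q n).1.2 + (q n).2.
  by apply: (nest (fun q => q.1.2)) => n; have [_ _] := nxtP n.
have q1 n : 0 <= (q n).1.1.
  by elim: n => // n IH; have [_ /andP [/(le_trans IH)]] := nxtP n.
have q2 n : 0 <= (q n).1.2.
  by elim: n => // n IH; have [_ _ /andP [/(le_trans IH)]] := nxtP n.
have [||d d0 dP] := Ploc x y.
- by case/andP: (xP 0%N) => + _; apply: le_trans.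
- by case/andP: (yP 0%N) => + _; apply: le_trans.
have [n nd] := exists_half_pow_lt l d0.
by apply: (qP n); apply: dP => //; rewrite ql.
Qed.

End dyadic.

(** * Differentiable paths and their primitives *)

(** [Cplx R] is normed over itself and not over [R], so derivatives with respect
    to a real parameter are taken coordinatewise. *)
Definition path_deriv (R : realType) (G : R -> Cplx R) (t : R) (l : Cplx R) :=
  is_derive t 1 (fun s => complex.Re (G s)) (complex.Re l) /\
  is_derive t 1 (fun s => complex.Im (G s)) (complex.Im l).

Definition path_continuous (R : realType) (g : R -> Cplx R) :=
  forall t (e : R), 0 < e -> exists2 d, 0 < d &
    forall s, `|s - t| < d -> cabs (g s - g t) < e.

(** The base point -1 makes this differentiable on both sides at every parameter
    of the half line [0 <= t], where all integrals are taken.  Integrals are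
    differences of values of this primitive, so that their additivity is plain
    algebra. *)
Definition cprimitive (R : realType) (g : R -> Cplx R) (x : R) : Cplx R :=
  Complex (\int[lebesgue_measure]_(t in `[-1, x]) complex.Re (g t))
          (\int[lebesgue_measure]_(t in `[-1, x]) complex.Im (g t)).

Section paths.
Context {R : realType}.
Implicit Types (G g : R -> Cplx R) (t : R) (z w l : Cplx R).

Lemma path_derivD G1 G2 t l1 l2 : path_deriv G1 t l1 -> path_deriv G2 t l2 ->
  path_deriv (fun s => G1 s + G2 s) t (l1 + l2).
Proof.
move=> [h1 h2] [h3 h4]; split; rewrite ?ReD ?ImD.
  under eq_fun do rewrite ReD; exact: is_deriveD.
under eq_fun do rewrite ImD; exact: is_deriveD.
Qed.

Lemma path_derivB G1 G2 t l1 l2 : path_deriv G1 t l1 -> path_deriv G2 t l2 ->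
  path_deriv (fun s => G1 s - G2 s) t (l1 - l2).
Proof.
move=> [h1 h2] [h3 h4]; split; rewrite ?ReB ?ImB.
  under eq_fun do rewrite ReB; exact: is_deriveB.
under eq_fun do rewrite ImB; exact: is_deriveB.
Qed.

Lemma path_derivM G1 G2 t l1 l2 : path_deriv G1 t l1 -> path_deriv G2 t l2 ->
  path_deriv (fun s => G1 s * G2 s) t (l1 * G2 t + G1 t * l2).
Proof.
move=> [h1 h2] [h3 h4]; split.
  under eq_fun do rewrite ReM.
  apply: is_derive_eq; rewrite /GRing.scale /= ReD !ReM; ring.
under eq_fun do rewrite ImM.
apply: is_derive_eq; rewrite /GRing.scale /= ImD !ImM; ring.
Qed.

Lemma path_deriv_cst z t : path_deriv (fun=> z) t 0.
Proof. by split; exact: is_derive_cst. Qed.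

Lemma path_deriv_cofr (a : R -> R) t (l : R) : is_derive t 1 a l ->
  path_deriv (fun s => cofr (a s)) t (cofr l).
Proof. by move=> h; split => //=; exact: is_derive_cst. Qed.

Lemma path_deriv_eq G t l l' : path_deriv G t l -> l = l' -> path_deriv G t l'.
Proof. by move=> + <-. Qed.

(** The factor 2 comes from applying the real mean value theorem to the real and
    imaginary parts separately. *)
Lemma path_mean_value G (g : R -> Cplx R) (a b M : R) : a <= b ->
  (forall t, a <= t <= b -> path_deriv G t (g t)) ->
  (forall t, a <= t <= b -> cabs (g t) <= M) ->
  cabs (G b - G a) <= 2 * M * (b - a).
Proof.
move=> ab dG gM.
have aux (F f : R -> R) : (forall t, a <= t <= b -> is_derive t 1 F (f t)) ->
    (forall t, a <= t <= b -> `|f t| <= M) -> `|F b - F a| <= M * (b - a).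
  move=> dF fM; have [|||c cab ->] := @MVT_segment _ F f a b.
  - exact: ab.
  - by move=> x; rewrite in_itv /= => /andP [/ltW ax /ltW xb]; apply: dF; rewrite ax xb.
  - apply: derivable_within_continuous => x; rewrite in_itv /= => xab.
    by have := dF _ xab; case.
  rewrite normrM (ger0_norm (_ : 0 <= b - a)) ?subr_ge0 // ler_wpM2r ?subr_ge0 //.
  by apply: fM; rewrite in_itv in cab.
apply: le_trans (cabs_le_ReIm _) _; rewrite -mulrA mulr_natl mulr2n ReB ImB.
apply: lerD.
  apply: (aux (fun s => complex.Re (G s)) (fun s => complex.Re (g s))) => t tab.
    by have [] := dG t tab.
  exact: le_trans (Re_le_cabs _) (gM _ tab).
apply: (aux (fun s => complex.Im (G s)) (fun s => complex.Im (g s))) => t tab.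
  by have [] := dG t tab.
exact: le_trans (Im_le_cabs _) (gM _ tab).
Qed.

Lemma cprimitive_deriv g t : path_continuous g -> -1 < t ->
  path_deriv (cprimitive g) t (g t).
Proof.
move=> cg t1.
have aux (f : R -> R) : continuous f ->
    is_derive t 1 (fun x => \int[lebesgue_measure]_(s in `[-1, x]) f s) (f t).
  move=> cf; have [||||] := @continuous_FTC1_closed _ f (-1) t (t + 1).
  - by rewrite ltrDl.
  - apply: continuous_compact_integrable; first exact: segment_compact.
    exact: continuous_subspaceT.
  - exact: t1.
  - exact: cf.
  by move=> h1 h2; apply: DeriveDef; [exact: h1 | rewrite -derive1E; exact: h2].
have cont (f : R -> R) : (forall s, forall u, `|f s - f u| <= cabs (g s - g u)) -> continuous f.
  move=> fg x; apply/cvgrPdist_lt => e e0; have [d d0 dP] := cg x e e0.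
  have := nbhsx_ballx x d d0; apply: filterS => s; rewrite /ball /= => xs.
  by rewrite distrC; apply: le_lt_trans (fg _ _) (dP _ _); rewrite distrC.
split; apply: aux; apply: cont => s u.
  by rewrite -ReB Re_le_cabs.
by rewrite -ImB Im_le_cabs.
Qed.

Lemma path_deriv_continuous G (g : R -> Cplx R) :
  (forall t, path_deriv G t (g t)) -> path_continuous G.
Proof.
move=> dG t e e0.
have e2 : 0 < e / 2 by rewrite divr_gt0.
have aux (F f : R -> R) : (forall t, is_derive t 1 F (f t)) ->
  exists2 d, 0 < d & forall s, `|s - t| < d -> `|F s - F t| < e / 2.
  move=> dF; have : {for t, continuous F}.
    by apply: differentiable_continuous; apply/derivable1_diffP; case: (dF t).
  move=> /cvgrPdist_lt /(_ _ e2) /nbhs_ballP [d /= d0 dP].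
  by exists d => // s st; rewrite distrC; apply: dP; rewrite /ball /= distrC.
have [d1 d10 d1P] := aux (fun s => complex.Re (G s)) _ (fun t => (dG t).1).
have [d2 d20 d2P] := aux (fun s => complex.Im (G s)) _ (fun t => (dG t).2).
exists (Num.min d1 d2); first by rewrite lt_min d10 d20.
move=> s; rewrite lt_min => /andP [s1 s2].
apply: le_lt_trans (cabs_le_ReIm _) _; rewrite ReB ImB (splitr e).
by apply: ltrD; [exact: d1P | exact: d2P].
Qed.

Lemma cst_path_continuous z : path_continuous (fun _ : R => z).
Proof. by move=> t e e0; exists 1 => // s _; rewrite subrr cabs0. Qed.

Lemma path_continuousM g1 g2 : path_continuous g1 -> path_continuous g2 ->
  path_continuous (fun s => g1 s * g2 s).
Proof.
move=> c1 c2 t e e0.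
pose K := cabs (g1 t) + cabs (g2 t) + 1.
have K0 : 0 < K by rewrite ltr_wpDl // addr_ge0 ?cabs_ge0.
pose h := Num.min 1 (e / (2 * K)).
have h0 : 0 < h by rewrite lt_min ltr01 divr_gt0 // mulr_gt0.
have [d1 d10 d1P] := c1 t h h0; have [d2 d20 d2P] := c2 t h h0.
exists (Num.min d1 d2); first by rewrite lt_min d10 d20.
move=> s; rewrite lt_min => /andP [/d1P s1 /d2P s2].
have -> : g1 s * g2 s - g1 t * g2 t =
  (g1 s - g1 t) * (g2 s - g2 t) + (g1 t * (g2 s - g2 t) + g2 t * (g1 s - g1 t)) by ring.
apply: le_lt_trans (cabsD _ _) _.
apply: le_lt_trans (lerD (lexx _) (cabsD _ _)) _; rewrite !cabsM.
have h1 : h <= 1 by rewrite ge_min lexx.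
have hK : h * K <= e / 2.
  have : h <= e / (2 * K) by rewrite ge_min lexx orbT.
  by rewrite ler_pdivlMr ?mulr_gt0 // => hh; rewrite ler_pdivlMr //; lra.
have a1 := cabs_ge0 (g1 t); have a2 := cabs_ge0 (g2 t).
have b1 := cabs_ge0 (g1 s - g1 t); have b2 := cabs_ge0 (g2 s - g2 t).
have m1 : cabs (g1 s - g1 t) * cabs (g2 s - g2 t) <= h * 1.
  by apply: ler_pM => //; [exact: ltW | apply: le_trans h1; exact: ltW].
have m2 : cabs (g1 t) * cabs (g2 s - g2 t) <= cabs (g1 t) * h.
  by rewrite ler_wpM2l // ltW.
have m3 : cabs (g2 t) * cabs (g1 s - g1 t) <= cabs (g2 t) * h.
  by rewrite ler_wpM2l // ltW.
by apply: le_lt_trans (lerD m1 (lerD m2 m3)) _; rewrite /K in hK *; nra.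
Qed.

End paths.

(** * Goursat's lemma in parameter space *)
Section goursat.
Context {R : realType}.
Variables (a a' : R -> R) (b b' : R -> Cplx R) (K : R) (X : R -> R -> Cplx R).
Hypothesis da : forall u : R, is_derive u (1 : R) a (a' u).
Hypothesis a1 : forall u, `|a u| <= 1.
Hypothesis a'1 : forall u, `|a' u| <= 1.
Hypothesis ca' : path_continuous (fun u => cofr (a' u)).
Hypothesis db : forall t, path_deriv b t (b' t).
Hypothesis bK : forall t, cabs (b t) <= K.
Hypothesis b'K : forall t, cabs (b' t) <= K.
Hypothesis cb' : path_continuous b'.
Hypothesis cX1 : forall t, path_continuous (X^~ t).
Hypothesis cX2 : forall u, path_continuous (X u).
Hypothesis Xloc : forall u0 t0, 0 <= u0 -> 0 <= t0 -> exists A B : Cplx R,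
  forall e : R, 0 < e -> exists2 d : R, 0 < d & forall u t,
    `|u - u0| < d -> `|t - t0| < d ->
    cabs (X u t - A - B * (cofr (a u) * b t)) <= e * (`|u - u0| + `|t - t0|).

(** Think of [X u t = g (z + a u * b t)] for a holomorphic [g].  The form [g dz]
    pulls back to [X * (a db + b da)]; [tside] and [uside] integrate it along the
    lines of constant [u] and of constant [t], and [square_sum] is its integral
    along the boundary of a square, up to sign. *)
Definition tside (u : R) := cprimitive (fun t => X u t * (cofr (a u) * b' t)).
Definition uside (t : R) := cprimitive (fun u => X u t * (b t * cofr (a' u))).
Definition square_sum u t l :=
  (tside (u + l) (t + l) - tside (u + l) t) - (tside u (t + l) - tside u t)
  - (uside (t + l) (u + l) - uside (t + l) u) + (uside t (u + l) - uside t u).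

Lemma tside_deriv u t : 0 <= t -> path_deriv (tside u) t (X u t * (cofr (a u) * b' t)).
Proof.
move=> t0; apply: cprimitive_deriv; last by apply: lt_le_trans t0; rewrite oppr_lt0.
apply: path_continuousM => //; apply: path_continuousM => //.
exact: cst_path_continuous.
Qed.

Lemma uside_deriv t u : 0 <= u -> path_deriv (uside t) u (X u t * (b t * cofr (a' u))).
Proof.
move=> u0; apply: cprimitive_deriv; last by apply: lt_le_trans u0; rewrite oppr_lt0.
apply: path_continuousM => //; apply: path_continuousM => //.
exact: cst_path_continuous.
Qed.

(** The pull-back of an affine function [A + B * w] has the explicit primitive
    [A * a * b + B / 2 * (a * b) ^+ 2], so only the deviation of [X] from
    such a function contributes to the boundary integral. *)
Lemma square_sum_small u t l u0 t0 e : 0 <= u -> 0 <= t -> 0 < l -> 0 < e ->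
  forall A B : Cplx R,
  u <= u0 <= u + l -> t <= t0 <= t + l ->
  (forall u' t', u <= u' <= u + l -> t <= t' <= t + l ->
     cabs (X u' t' - A - B * (cofr (a u') * b t')) <= e * (l + l)) ->
  cabs (square_sum u t l) <= e * (16 * K * l ^+ 2).
Proof.
move=> pu pt l0 e0 A B ul tl Xe.
have K0 : 0 <= K := le_trans (cabs_ge0 _) (bK 0).
pose Y u t := X u t - A - B * (cofr (a u) * b t).
pose G s := tside (u + l) s - tside u s - (A * (cofr (a (u + l)) - cofr (a u)) * b s
  + B / 2 * (cofr (a (u + l)) * cofr (a (u + l)) - cofr (a u) * cofr (a u)) * (b s * b s)).
pose G' s := uside (t + l) s - uside t s - (A * (b (t + l) - b t) * cofr (a s)
  + B / 2 * (b (t + l) * b (t + l) - b t * b t) * (cofr (a s) * cofr (a s))).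
have M0 : 0 <= e * (l + l) by rewrite mulr_ge0 ?addr_ge0 // ltW.
have hG : cabs (G (t + l) - G t) <= 2 * (e * (l + l) * K + e * (l + l) * K) * (t + l - t).
  apply: (@path_mean_value _ _
    (fun s => Y (u + l) s * (cofr (a (u + l)) * b' s) - Y u s * (cofr (a u) * b' s))).
  - by rewrite lerDl ltW.
  - move=> s /andP [ts _]; have s0 := le_trans pt ts.
    apply: path_deriv_eq.
      apply: path_derivB; first by apply: path_derivB; exact: tside_deriv.
      apply: path_derivD.
        by apply: path_derivM; [exact: path_deriv_cst | exact: db].
      apply: path_derivM; first exact: path_deriv_cst.
      by apply: path_derivM; exact: db.
    by rewrite /Y; field.
  - move=> s tsl; apply: le_trans (cabsD _ _) _; rewrite cabsN !cabsM !cabs_cofr.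
    have w v : u <= v <= u + l -> cabs (Y v s) * (`|a v| * cabs (b' s)) <= e * (l + l) * K.
      move=> uv; apply: ler_pM; rewrite ?mulr_ge0 ?cabs_ge0 //; first exact: Xe.
      by rewrite -[leRHS]mul1r; apply: ler_pM; rewrite ?cabs_ge0.
    by apply: lerD; apply: w; rewrite !lexx /= ?lerDl (ltW l0).
have hG' : cabs (G' (u + l) - G' u) <= 2 * (e * (l + l) * K + e * (l + l) * K) * (u + l - u).
  apply: (@path_mean_value _ _
    (fun s => Y s (t + l) * (b (t + l) * cofr (a' s)) - Y s t * (b t * cofr (a' s)))).
  - by rewrite lerDl ltW.
  - move=> s /andP [us _]; have s0 := le_trans pu us.
    have dc := path_deriv_cofr (da s).
    apply: path_deriv_eq.
      apply: path_derivB; first by apply: path_derivB; exact: uside_deriv.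
      apply: path_derivD.
        by apply: path_derivM; [exact: path_deriv_cst | exact: dc].
      apply: path_derivM; first exact: path_deriv_cst.
      by apply: path_derivM; exact: dc.
    by rewrite /Y; field.
  - move=> s usl; apply: le_trans (cabsD _ _) _; rewrite cabsN !cabsM !cabs_cofr.
    have w v : t <= v <= t + l -> cabs (Y s v) * (cabs (b v) * `|a' s|) <= e * (l + l) * K.
      move=> uv; apply: ler_pM; rewrite ?mulr_ge0 ?cabs_ge0 //; first exact: Xe.
      by rewrite -[leRHS]mulr1; apply: ler_pM; rewrite ?cabs_ge0.
    by apply: lerD; apply: w; rewrite !lexx /= ?lerDl (ltW l0).
have -> : square_sum u t l = (G (t + l) - G t) - (G' (u + l) - G' u).
  by rewrite /square_sum /G /G'; move: tside uside => V H; field.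
apply: le_trans (cabsD _ _) _; rewrite cabsN; apply: le_trans (lerD hG hG') _.
by rewrite le_eqVlt; apply/orP; left; apply/eqP; ring.
Qed.

(** Both [square_sum] and the area are additive under subdivision, and
    [square_sum] is at most an arbitrarily small multiple of the area for small
    squares around any given point, hence for all squares. *)
Theorem square_sum_eq0 u t l : 0 <= u -> 0 <= t -> 0 < l -> square_sum u t l = 0.
Proof.
move=> pu pt l0; apply/eqP; rewrite -cabs_eq0 eq_le cabs_ge0 andbT.
have K0 : 0 <= K := le_trans (cabs_ge0 _) (bK 0).
have key e : 0 < e -> cabs (square_sum u t l) <= e * (16 * K * l ^+ 2).
  move=> e0; apply: (@dyadic_induction R
    (fun u t l => cabs (square_sum u t l) <= e * (16 * K * l ^+ 2))) => //.
    move=> {}u {}t {}l {pu pt l0} h1 h2 h3 h4.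
    have -> : square_sum u t l = square_sum u t (l / 2) + square_sum (u + l / 2) t (l / 2) +
      (square_sum u (t + l / 2) (l / 2) + square_sum (u + l / 2) (t + l / 2) (l / 2)).
      have E x : x + l / 2 + l / 2 = x + l by field.
      by rewrite /square_sum !E; move: tside uside => V H; ring.
    apply: le_trans (cabsD _ _) _.
    apply: le_trans (lerD (cabsD _ _) (cabsD _ _)) _.
    apply: le_trans (lerD (lerD h1 h2) (lerD h3 h4)) _.
    by rewrite le_eqVlt; apply/orP; left; apply/eqP; field.
  move=> u0 t0 pu0 pt0; have [A [B h]] := Xloc pu0 pt0.
  have [d d0 dP] := h e e0; exists d => // {pu pt l0}u {}t {}l pu pt l0 ld ul tl.
  have dist (x0 x y : R) : x <= x0 <= x + l -> x <= y <= x + l -> `|y - x0| <= l.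
    by move=> /andP [? ?] /andP [? ?]; apply/ler_normlP; split; lra.
  apply: (square_sum_small pu pt l0 e0 ul tl (A := A) (B := B)) => u' t' uu tt.
  have hu := dist _ _ _ ul uu; have ht := dist _ _ _ tl tt.
  apply: le_trans (dP _ _ (le_lt_trans hu ld) (le_lt_trans ht ld)) _.
  by rewrite ler_wpM2l ?(ltW e0) // lerD.
rewrite leNgt; apply/negP => S0.
pose M := 16 * K * l ^+ 2 + 1.
have N0 : 0 <= 16 * K * l ^+ 2 by rewrite mulr_ge0 ?sqr_ge0 // mulr_ge0.
have M0 : 0 < M by rewrite /M; lra.
have M2 : 0 < 2 * M by rewrite mulr_gt0.
have := key _ (divr_gt0 S0 M2); apply/negP; rewrite -ltNge.
set S := cabs _ in S0 *.
by rewrite mulrAC ltr_pdivrMr // ltr_pM2l // /M; lra.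
Qed.

End goursat.

(** * Integration over a period *)
Section period.
Context {R : realType}.
Implicit Types (G g : R -> Cplx R) (t : R) (z w l : Cplx R).

Lemma path_lipschitz G g (M : R) : (forall t, path_deriv G t (g t)) ->
  (forall t, cabs (g t) <= M) -> forall s t, cabs (G s - G t) <= 2 * M * `|s - t|.
Proof.
move=> dG gM s t; wlog ts : s t / t <= s.
  by move=> h; have [/h//|/ltW/h] := leP t s; rewrite cdistrC distrC.
by rewrite ger0_norm ?subr_ge0 //; exact: (path_mean_value ts (g := g)).
Qed.

Lemma path_continuous_comp (f : Cplx R -> Cplx R) (p : R -> Cplx R) :
  (forall t, derivable f (p t) 1) -> path_continuous p -> path_continuous (fun t => f (p t)).
Proof.
move=> df cp t e e0; have [l dl] := (derivable_cderiv _ _).1 (df t).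
have [d d0 dP] := has_cderiv_continuous dl e0; have [d' d'0 d'P] := cp t d d0.
by exists d' => // s /d'P /dP.
Qed.

Lemma path_continuousD g1 g2 : path_continuous g1 -> path_continuous g2 ->
  path_continuous (fun s => g1 s + g2 s).
Proof.
move=> c1 c2 t e e0; have e2 : 0 < e / 2 by rewrite divr_gt0.
have [d1 d10 d1P] := c1 t _ e2; have [d2 d20 d2P] := c2 t _ e2.
exists (Num.min d1 d2); first by rewrite lt_min d10 d20.
move=> s; rewrite lt_min => /andP [/d1P s1 /d2P s2].
have -> : g1 s + g2 s - (g1 t + g2 t) = (g1 s - g1 t) + (g2 s - g2 t) by ring.
by apply: le_lt_trans (cabsD _ _) _; rewrite (splitr e) ltrD.
Qed.

Lemma path_continuousX g n : path_continuous g -> path_continuous (fun s => g s ^+ n).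
Proof.
move=> cg; elim: n => [|n IH]; first exact: cst_path_continuous.
by under eq_fun do rewrite exprS; exact: path_continuousM.
Qed.

Lemma path_deriv0_eq G (a b : R) : a <= b ->
  (forall t, a <= t <= b -> path_deriv G t 0) -> G b = G a.
Proof.
move=> ab dG; apply/eqP; rewrite -subr_eq0 -cabs_eq0 eq_le cabs_ge0 andbT.
have := path_mean_value (g := fun=> 0) (M := 0) ab dG.
by rewrite mulr0 mul0r; apply => t _; rewrite cabs0.
Qed.

Definition period_int g : Cplx R := cprimitive g (pi *+ 2) - cprimitive g 0.

Lemma two_pi_gt0 : 0 < pi *+ 2 :> R.
Proof. by rewrite mulrn_wgt0 // pi_gt0. Qed.

Lemma two_pi_ge0 : 0 <= pi *+ 2 :> R.
Proof. exact/ltW/two_pi_gt0. Qed.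

Lemma period_int_deriv G g : path_continuous g -> (forall t, path_deriv G t (g t)) ->
  period_int g = G (pi *+ 2) - G 0.
Proof.
move=> cg dG; have := @path_deriv0_eq (fun t => cprimitive g t - G t) 0 (pi *+ 2) two_pi_ge0.
rewrite /period_int => h; apply/eqP; rewrite -subr_eq0; apply/eqP.
have -> : cprimitive g (pi *+ 2) - cprimitive g 0 - (G (pi *+ 2) - G 0) =
  (cprimitive g (pi *+ 2) - G (pi *+ 2)) - (cprimitive g 0 - G 0) by ring.
rewrite h ?subrr // => t /andP [t0 _]; apply: path_deriv_eq.
  by apply: path_derivB; [apply: cprimitive_deriv => //; lra | exact: dG].
by rewrite subrr.
Qed.

Lemma period_int_le g M : path_continuous g -> (forall t, cabs (g t) <= M) ->
  cabs (period_int g) <= 2 * M * (pi *+ 2).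
Proof.
move=> cg gM; rewrite -[X in _ <= _ * X]subr0.
apply: (@path_mean_value _ (cprimitive g) g) => [|t /andP [t0 _]|//].
  exact: two_pi_ge0.
by apply: cprimitive_deriv => //; lra.
Qed.

Lemma period_intD g1 g2 : path_continuous g1 -> path_continuous g2 ->
  period_int (fun t => g1 t + g2 t) = period_int g1 + period_int g2.
Proof.
move=> c1 c2; have := @path_deriv0_eq (fun t => cprimitive (fun t => g1 t + g2 t) t -
   (cprimitive g1 t + cprimitive g2 t)) 0 (pi *+ 2) two_pi_ge0.
move=> h; apply/eqP; rewrite -subr_eq0; apply/eqP.
have -> : period_int (fun t => g1 t + g2 t) - (period_int g1 + period_int g2) =
  (cprimitive (fun t => g1 t + g2 t) (pi *+ 2) - (cprimitive g1 (pi *+ 2) + cprimitive g2 (pi *+ 2)))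
  - (cprimitive (fun t => g1 t + g2 t) 0 - (cprimitive g1 0 + cprimitive g2 0)).
  by rewrite /period_int; ring.
rewrite h ?subrr // => t /andP [t0 _]; have t1 : -1 < t by lra.
apply: path_deriv_eq.
  apply: path_derivB; first by apply: cprimitive_deriv => //; exact: path_continuousD.
  by apply: path_derivD; exact: cprimitive_deriv.
by rewrite subrr.
Qed.

Lemma period_intZ z g : path_continuous g ->
  period_int (fun t => z * g t) = z * period_int g.
Proof.
move=> c1; have := @path_deriv0_eq (fun t => cprimitive (fun t => z * g t) t -
   z * cprimitive g t) 0 (pi *+ 2) two_pi_ge0.
move=> h; apply/eqP; rewrite -subr_eq0; apply/eqP.
have -> : period_int (fun t => z * g t) - z * period_int g =
  (cprimitive (fun t => z * g t) (pi *+ 2) - z * cprimitive g (pi *+ 2))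
  - (cprimitive (fun t => z * g t) 0 - z * cprimitive g 0).
  by rewrite /period_int; ring.
rewrite h ?subrr // => t /andP [t0 _]; have t1 : -1 < t by lra.
apply: path_deriv_eq.
  apply: path_derivB; first by apply: cprimitive_deriv => //;
    apply: path_continuousM => //; exact: cst_path_continuous.
  by apply: path_derivM; [exact: path_deriv_cst | exact: cprimitive_deriv].
by rewrite mul0r add0r subrr.
Qed.

Lemma period_intB g1 g2 : path_continuous g1 -> path_continuous g2 ->
  period_int (fun t => g1 t - g2 t) = period_int g1 - period_int g2.
Proof.
move=> c1 c2; have c3 := path_continuousM (cst_path_continuous (-1)) c2.
have := period_intD c1 c3; rewrite period_intZ // mulN1r => <-.
by congr period_int; apply/funext => t; rewrite mulN1r.
Qed.

End period.

Definition cis (R : realType) (t : R) : Cplx R := Complex (cos t) (sin t).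

Section circle.
Context {R : realType}.
Implicit Types (t : R).
Local Notation ii := (Complex 0 1 : Cplx R).

Lemma cabs_cis t : cabs (cis t) = 1.
Proof. by rewrite /cabs /= cos2Dsin2 sqrtr1. Qed.

Lemma cis_neq0 t : cis t != 0.
Proof. by rewrite -cabs_eq0 cabs_cis oner_eq0. Qed.

Lemma cabs_i : cabs ii = 1.
Proof. by rewrite /cabs /= expr0n add0r expr1n sqrtr1. Qed.

Lemma cis_deriv t : path_deriv (@cis R) t (ii * cis t).
Proof.
split; rewrite ?ReM ?ImM /= ?mul0r ?mul1r ?sub0r ?add0r.
  exact: is_derive_cos.
by rewrite ?addr0; exact: is_derive_sin.
Qed.

Lemma cisV t : (cis t)^-1 = cis (- t).
Proof.
apply: (mulfI (cis_neq0 t)); rewrite mulfV ?cis_neq0 //.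
apply: cplx_eq; rewrite ?ReM ?ImM /= cosN sinN mulrN.
  by rewrite opprK -!expr2 cos2Dsin2.
by rewrite addrC mulrC subrr.
Qed.

Lemma cisV_deriv t : path_deriv (fun t => (@cis R t)^-1) t (- ii * (cis t)^-1).
Proof.
under eq_fun do rewrite cisV; rewrite cisV.
split; rewrite ?ReM ?ImM /= ?oppr0 ?mul0r ?mul1r ?sub0r ?add0r.
  rewrite mulN1r opprK; under eq_fun do rewrite cosN.
  by rewrite sinN; exact: is_derive_cos.
rewrite ?addr0 ?add0r mulN1r cosN; under eq_fun do rewrite sinN.
exact: is_deriveN.
Qed.

Lemma cis2pi : cis (pi *+ 2) = cis 0 :> Cplx R.
Proof. by rewrite /cis cos2pi sin2pi cos0 sin0. Qed.

End circle.

(** * Cauchy's formula on a circle *)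
Section shrink.
Context {R : realType}.
Implicit Types u : R.
(** A contraction factor for the homotopy of a circle to a point.  It is defined
    and smooth for all real [u], equals 1 at 0 and never vanishes: no parameter
    has to be kept inside an interval, and the singular point is only approached
    at infinity. *)
Definition shrink u : R := (1 + u ^+ 2)^-1.
Definition shrink' u : R := - (shrink u ^+ 2 * (2 * u)).

Lemma shrink_den u : 1 <= 1 + u ^+ 2.
Proof. by rewrite lerDl sqr_ge0. Qed.
Lemma shrink_gt0 u : 0 < shrink u.
Proof. by rewrite invr_gt0 (lt_le_trans ltr01) ?shrink_den. Qed.
Lemma shrink_le1 u : shrink u <= 1.
Proof. by rewrite invf_le1 ?shrink_den // (lt_le_trans ltr01) ?shrink_den. Qed.

Lemma shrink_deriv u : is_derive u 1 shrink (shrink' u).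
Proof.
have d0 : 1 + u ^+ 2 != 0 by rewrite gt_eqF // (lt_le_trans ltr01) ?shrink_den.
have dd : is_derive u (1 : R) (fun u : R => 1 + u ^+ 2) (2 * u).
  apply: is_derive_eq; rewrite /GRing.scale /= add0r; ring.
have dv := @is_deriveV _ (fun u : R => 1 + u ^+ 2) u _ 1 d0 dd; apply: is_derive_eq.
by rewrite /shrink' /shrink /GRing.scale /= exprVn mulNr.
Qed.

Lemma shrink'_le1 u : `|shrink' u| <= 1.
Proof.
have d1 := shrink_den u; have d0 : 0 < 1 + u ^+ 2 by apply: lt_le_trans d1.
rewrite normrN normrM ger0_norm ?sqr_ge0 // /shrink exprVn mulrC ler_pdivrMr ?exprn_gt0 //.
rewrite mul1r expr2; apply: le_trans (_ : 1 + u ^+ 2 <= _).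
  have := sqr_ge0 (`|u| - 1); rewrite normrM (ger0_norm (ler0n R 2)) sqrrB1 -normrX.
  by rewrite (ger0_norm (sqr_ge0 u)); lra.
by rewrite -[leLHS]mul1r ler_pM2r.
Qed.

Lemma shrink_continuous : path_continuous (fun u => cofr (shrink u)).
Proof.
by apply: path_deriv_continuous => u; apply: path_deriv_cofr; exact: shrink_deriv.
Qed.

Lemma shrink'_continuous : path_continuous (fun u => cofr (shrink' u)).
Proof.
have -> : (fun u => cofr (shrink' u)) =
  (fun u => (cofr (-2) * (cofr (shrink u)) ^+ 2) * cofr u).
  apply/funext => u; rewrite /shrink' !expr2 -!cofrM; congr cofr; ring.
apply: path_continuousM.
  apply: path_continuousM; first exact: cst_path_continuous.
  exact/path_continuousX/shrink_continuous.
by apply: path_deriv_continuous => u; apply: path_deriv_cofr; exact: is_derive_id.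
Qed.

End shrink.

Section cauchy.
Context {R : realType}.
Local Notation ii := (Complex 0 1 : Cplx R).
Variables (f : Cplx R -> Cplx R) (x z : Cplx R) (rho r : R).
Hypothesis rho0 : 0 < rho.
Hypothesis rho_r : rho < r.
Hypothesis df : forall w, cabs (w - x) < r -> derivable f w 1.
Hypothesis zx : cabs (z - x) < rho.

(** The circle [x + c t] is contracted towards [z] by [Phi u t]; [b t] is the
    vector from [z] to the circle. *)
Let c t : Cplx R := cofr rho * cis t.
Let b t : Cplx R := x + c t - z.
Let b' t : Cplx R := ii * c t.
Let q (w : Cplx R) := (f w - f z) / (w - z).
Let Phi (u t : R) : Cplx R := z + cofr (shrink u) * b t.

Let c_abs t : cabs (c t) = rho.
Proof. by rewrite cabsM cabs_cofr cabs_cis mulr1 ger0_norm // ltW. Qed.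

Let db t : path_deriv b t (b' t).
Proof.
apply: path_deriv_eq.
  apply: path_derivB; last exact: path_deriv_cst.
  apply: path_derivD; first exact: path_deriv_cst.
  by apply: path_derivM; [exact: path_deriv_cst | exact: cis_deriv].
by rewrite mul0r !add0r subr0 /b' /c mulrCA.
Qed.

Let bK t : cabs (b t) <= 2 * rho.
Proof.
have -> : b t = c t - (z - x) by rewrite /b; ring.
by apply: le_trans (cabsD _ _) _; rewrite cabsN c_abs mulr_natl mulr2n lerD2l ltW.
Qed.

Let b'K t : cabs (b' t) <= 2 * rho.
Proof. by rewrite cabsM cabs_i c_abs mul1r ler_peMl // ?ler1n // ltW. Qed.

Let b_ge t : rho - cabs (z - x) <= cabs (b t).
Proof.
have -> : b t = c t - (z - x) by rewrite /b; ring.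
by have := cabsB (c t) (z - x); rewrite c_abs.
Qed.

Let b_neq0 t : b t != 0.
Proof. by rewrite -cabs_gt0; apply: lt_le_trans (b_ge t); rewrite subr_gt0. Qed.

Let b_cont : path_continuous b.
Proof. exact: path_deriv_continuous db. Qed.

Let b'_cont : path_continuous b'.
Proof.
apply: path_continuousM; first exact: cst_path_continuous.
apply: path_continuousM; first exact: cst_path_continuous.
exact: path_deriv_continuous (@cis_deriv R).
Qed.

Let Phi_in u t : cabs (Phi u t - x) < r.
Proof.
apply: le_lt_trans rho_r.
have -> : Phi u t - x = cofr (1 - shrink u) * (z - x) + cofr (shrink u) * c t.
  have -> : cofr (1 - shrink u) = 1 - cofr (shrink u) :> Cplx R.
    by rewrite /cofr rmorphB rmorph1.
  by rewrite /Phi /b; ring.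
apply: le_trans (cabsD _ _) _; rewrite (cabsM (cofr (1 - _))) (cabsM (cofr (shrink u))).
rewrite c_abs !cabs_cofr.
have s0 := shrink_gt0 u; have s1 := shrink_le1 u.
rewrite ger0_norm ?subr_ge0 // ger0_norm ?(ltW s0) //.
have : (1 - shrink u) * cabs (z - x) <= (1 - shrink u) * rho.
  by rewrite ler_wpM2l ?subr_ge0 // ltW.
by lra.
Qed.

Let Phi_neq u t : Phi u t - z != 0.
Proof.
rewrite /Phi addrC addKr mulf_neq0 //.
by rewrite -cabs_eq0 cabs_cofr normr_eq0 gt_eqF ?shrink_gt0.
Qed.

Let dq u t : derivable q (Phi u t) 1.
Proof.
apply: derivableM.
  by apply: derivableB; [exact/df/Phi_in | exact: derivable_cst].
apply: derivableV; first exact: Phi_neq.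
by apply: derivableB; [exact: derivable_id | exact: derivable_cst].
Qed.

Let X u t := q (Phi u t).

Let X1 t : path_continuous (X^~ t).
Proof.
apply: path_continuous_comp => [u|]; first exact: dq.
apply: path_continuousD; first exact: cst_path_continuous.
by apply: path_continuousM; [exact: shrink_continuous | exact: cst_path_continuous].
Qed.

Let X2 u : path_continuous (X u).
Proof.
apply: path_continuous_comp => [t|]; first exact: dq.
apply: path_continuousD; first exact: cst_path_continuous.
by apply: path_continuousM; [exact: cst_path_continuous | exact: b_cont].
Qed.

Let Xloc (u0 t0 : R) : 0 <= u0 -> 0 <= t0 -> exists A B : Cplx R,
  forall e : R, 0 < e -> exists2 d : R, 0 < d & forall u t,
    `|u - u0| < d -> `|t - t0| < d ->
    cabs (X u t - A - B * (cofr (shrink u) * b t)) <= e * (`|u - u0| + `|t - t0|).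
Proof.
move=> _ _; have [l ql] := (derivable_cderiv _ _).1 (@dq u0 t0).
exists (q (Phi u0 t0) - l * (Phi u0 t0 - z)), l => e e0.
pose C := 4 * rho; have C0 : 0 < C by rewrite mulr_gt0.
have lip u t : cabs (Phi u t - Phi u0 t0) <= C * (`|u - u0| + `|t - t0|).
  have -> : Phi u t - Phi u0 t0 = (cofr (shrink u) - cofr (shrink u0)) * b t
     + cofr (shrink u0) * (b t - b t0) by rewrite /Phi; ring.
  apply: le_trans (cabsD _ _) _; rewrite !cabsM cabs_cofr.
  have h1 : cabs (cofr (shrink u) - cofr (shrink u0)) <= 2 * 1 * `|u - u0|.
    apply: (@path_lipschitz _ (fun u => cofr (shrink u)) (fun u => cofr (shrink' u))).
      by move=> v; apply: path_deriv_cofr; exact: shrink_deriv.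
    by move=> v; rewrite cabs_cofr shrink'_le1.
  have h2 : cabs (b t - b t0) <= 2 * (2 * rho) * `|t - t0|.
    exact: (path_lipschitz db b'K).
  have h3 : `|shrink u0| <= 1 by rewrite ger0_norm ?shrink_le1 // ltW ?shrink_gt0.
  have h4 : cabs (cofr (shrink u) - cofr (shrink u0)) * cabs (b t) <= 2 * 1 * `|u - u0| * (2 * rho).
    by apply: ler_pM; rewrite ?cabs_ge0.
  have h5 : `|shrink u0| * cabs (b t - b t0) <= 1 * (2 * (2 * rho) * `|t - t0|).
    by apply: ler_pM; rewrite ?cabs_ge0.
  by apply: le_trans (lerD h4 h5) _; rewrite /C; lra.
have [d d0 dP] := ql (e / C) (divr_gt0 e0 C0).
exists (d / (2 * C)); first by rewrite divr_gt0 // mulr_gt0.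
move=> u t; rewrite !ltr_pdivlMr ?mulr_gt0 // => hu ht.
have hl := lip u t.
have -> : X u t - (q (Phi u0 t0) - l * (Phi u0 t0 - z)) - l * (cofr (shrink u) * b t) =
  q (Phi u t) - q (Phi u0 t0) - l * (Phi u t - Phi u0 t0).
  have <- : Phi u t - z = cofr (shrink u) * b t by rewrite /Phi addrC addKr.
  by rewrite /X; move: (Phi u t) (Phi u0 t0) => p p0; ring.
apply: le_trans (dP _ _) _; first by apply: le_lt_trans hl _; lra.
apply: le_trans (_ : e / C * (C * (`|u - u0| + `|t - t0|)) <= _).
  by rewrite ler_wpM2l // ltW // divr_gt0.
by rewrite mulrA divfK ?gt_eqF.
Qed.

(** By Goursat's lemma and periodicity, the integral of [q] over the contracted
    circle takes the same value for [u] and [u + 2 pi].  It tends to 0 at infinity,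
    since [q w * (w - z) = f w - f z] does as [w] tends to [z]. *)
Lemma cauchy_difference_quotient : period_int (fun t =>
  (f (x + cofr rho * cis t) - f z) / (x + cofr rho * cis t - z) * (ii * (cofr rho * cis t))) = 0.
Proof.
pose T u := period_int (fun t => X u t * (cofr (shrink u) * b' t)).
have step u : 0 <= u -> T (u + pi *+ 2) = T u.
  move=> u0; have pi0 := @two_pi_gt0 R.
  have := square_sum_eq0 (@shrink_deriv R) _ (@shrink'_le1 R) (@shrink'_continuous R)
     db bK b'K b'_cont X1 X2 Xloc u0 (lexx 0) pi0.
  move=> /(_ (fun u => _)); rewrite /square_sum add0r.
  have -> : uside shrink' b X (pi *+ 2) = uside shrink' b X 0.
    by rewrite /uside /X /Phi /b /c cis2pi.
  have TE v : T v = tside shrink b' X v (pi *+ 2) - tside shrink b' X v 0 by [].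
  rewrite !TE; move: (tside _ _ _) (uside _ _ _) => V H h.
  apply/eqP; rewrite -subr_eq0 -[X in _ == X]h; last first.
    by move=> v; rewrite ger0_norm ?shrink_le1 // ltW ?shrink_gt0.
  by apply/eqP; ring.
have Tk k : T ((pi *+ 2) *+ k) = T 0.
  elim: k => [|k IH]; first by rewrite mulr0n.
  by rewrite (mulrSr (pi *+ 2)) step // mulrn_wge0 ?two_pi_ge0.
have -> : period_int (fun t => (f (x + cofr rho * cis t) - f z) / (x + cofr rho * cis t - z)
    * (ii * (cofr rho * cis t))) = T 0.
  congr period_int; apply/funext => t; rewrite /X /Phi /shrink expr0n addr0 invr1.
  have -> : cofr (1 : R) = 1 :> Cplx R by rewrite /cofr rmorph1.
  have E : z + b t = x + c t by rewrite /b addrC subrK.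
  by rewrite !mul1r E.
apply/eqP; rewrite -cabs_eq0 eq_le cabs_ge0 andbT; apply/ler_addgt0Pr => e e0.
rewrite add0r.
pose m := rho - cabs (z - x); have m0 : 0 < m by rewrite subr_gt0.
have pi0 := @two_pi_gt0 R.
pose e1 := e * m / (2 * (2 * rho) * (pi *+ 2)).
have den0 : 0 < 2 * (2 * rho) * (pi *+ 2) by rewrite !mulr_gt0.
have e10 : 0 < e1 by rewrite divr_gt0 // mulr_gt0.
have [l fl] := (derivable_cderiv _ _).1 (df (lt_trans zx rho_r)).
have [d d0 dP] := has_cderiv_continuous fl e10.
(* After [k] periods the contracted circle lies within distance [d] of [z]. *)
have [k kd] : exists k, 2 * rho / d < ((pi *+ 2) *+ k).
  exists (Num.bound (2 * rho / d)).
  apply: lt_le_trans (archi_boundP _) _; first by rewrite divr_ge0 ?mulr_ge0 // ltW.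
  rewrite -[leRHS]mulr_natl -[leLHS]mulr1 ler_wpM2l ?ler0n //.
  by rewrite mulr2n; have := pi_ge2 R; lra.
rewrite -(Tk k); set u := _ *+ k in kd *.
have u0 : 0 < u by apply: le_lt_trans kd; rewrite divr_ge0 ?mulr_ge0 // ltW.
have hs : shrink u * (2 * rho) < d.
  rewrite mulrC ltr_pdivrMr; last by rewrite (lt_le_trans ltr01) ?shrink_den.
  move: kd; rewrite ltr_pdivrMr // => /lt_le_trans; apply.
  rewrite [leRHS]mulrC ler_pM2r //; have := sqr_ge0 (u - 1/2); have := sqr_ge0 u.
  by rewrite sqrrB; lra.
apply: le_trans (period_int_le (M := e1 / m * (2 * rho)) _ _) _.
- apply: path_continuousM; first exact: X2.
  by apply: path_continuousM; [exact: cst_path_continuous | exact: b'_cont].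
- move=> t; rewrite mulrA cabsM; apply: ler_pM; rewrite ?cabs_ge0 //.
  have E : X u t * cofr (shrink u) = (f (Phi u t) - f z) / b t.
    rewrite /X /q /Phi [_ - z]addrC addKr.
    have s0 : cofr (shrink u) != 0 :> Cplx R.
      by rewrite -cabs_eq0 cabs_cofr normr_eq0 gt_eqF ?shrink_gt0.
    by field; rewrite s0 b_neq0.
  rewrite E cabsM cabsV; apply: ler_pM; rewrite ?cabs_ge0 ?invr_ge0 ?cabs_ge0 //.
    apply/ltW/dP; rewrite /Phi addrC addKr cabsM cabs_cofr ger0_norm; last exact/ltW/shrink_gt0.
    by apply: le_lt_trans hs; rewrite ler_wpM2l // ltW // shrink_gt0.
  by rewrite lef_pV2 ?posrE // ?b_ge // cabs_gt0.
have aux (P m' : R) : 0 < P -> 0 < m' ->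
    2 * (e * m' / (2 * (2 * rho) * P) / m' * (2 * rho)) * P = e.
  by move=> P0 m'0; field; rewrite (gt_eqF m'0) (gt_eqF P0) (gt_eqF rho0).
by rewrite /e1 aux.
Qed.

End cauchy.

(** * Taylor expansion with a uniform remainder *)
Section taylor.
Context {R : realType}.
Local Notation ii := (Complex 0 1 : Cplx R).
Implicit Types (F : R -> Cplx R) (zeta : Cplx R).

(** With [w = rho * cis t] on the circle and [v = 1 / w], the Cauchy kernel
    [dw / (w - zeta)] is [i dt / (1 - zeta * v)]. *)
Let v (rho : R) (t : R) : Cplx R := cofr (rho^-1) * (cis t)^-1.

Let v_cont rho : path_continuous (v rho).
Proof.
apply: path_continuousM; first exact: cst_path_continuous.
exact: path_deriv_continuous (@cisV_deriv R).
Qed.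

Let v_abs rho t : 0 < rho -> cabs (v rho t) = rho^-1.
Proof.
by move=> r0; rewrite /v cabsM cabsV cabs_cis invr1 mulr1 cabs_cofr ger0_norm // invr_ge0 ltW.
Qed.

Let zv_le rho zeta t : 0 < rho -> cabs zeta <= rho / 2 -> cabs (zeta * v rho t) <= 1 / 2.
Proof. by move=> r0 h; rewrite cabsM v_abs // ler_pdivrMr // mulrC mulrA mulr1. Qed.

Let den_ge rho zeta t : 0 < rho -> cabs zeta <= rho / 2 ->
  1 / 2 <= cabs (1 - zeta * v rho t).
Proof.
move=> r0 h; have := zv_le t r0 h; have := cabsB 1 (zeta * v rho t).
by rewrite cabs1; lra.
Qed.

Let den_neq0 rho zeta t : 0 < rho -> cabs zeta <= rho / 2 -> 1 - zeta * v rho t != 0.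
Proof. by move=> r0 h; rewrite -cabs_gt0; have := den_ge t r0 h; lra. Qed.

(** The tail from [n = N] on of the geometric series of the kernel, integrated
    against [F]; for [N = 0] it is the whole Cauchy integral. *)
Let rem rho zeta F N := period_int (fun t =>
  F t * (ii * ((zeta * v rho t) ^+ N / (1 - zeta * v rho t)))).

Let rem_cont rho zeta F N : 0 < rho -> cabs zeta <= rho / 2 -> path_continuous F ->
  path_continuous (fun t => F t * (ii * ((zeta * v rho t) ^+ N / (1 - zeta * v rho t)))).
Proof.
move=> r0 h cF; apply: path_continuousM => //.
apply: path_continuousM; first exact: cst_path_continuous.
apply: path_continuousM.
  apply/path_continuousX/path_continuousM; first exact: cst_path_continuous.
  exact: v_cont.
apply: (@path_continuous_comp _ (fun y => (1 - zeta * y)^-1)) => // t.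
apply: derivableV; first exact: den_neq0.
apply: derivableB; first exact: derivable_cst.
by apply: derivableM; [exact: derivable_cst | exact: derivable_id].
Qed.

Let coef_cont rho F n : path_continuous F -> path_continuous (fun t => F t * (ii * v rho t ^+ n)).
Proof.
move=> cF; apply: path_continuousM => //; apply: path_continuousM.
  exact: cst_path_continuous.
exact/path_continuousX/v_cont.
Qed.

Let rem_step rho zeta F N : 0 < rho -> cabs zeta <= rho / 2 -> path_continuous F ->
  rem rho zeta F N = zeta ^+ N * period_int (fun t => F t * (ii * v rho t ^+ N))
     + rem rho zeta F N.+1.
Proof.
move=> r0 h cF; rewrite -period_intZ; last exact: coef_cont.
rewrite -period_intD; last exact: rem_cont.
  congr period_int; apply/funext => t; have d0 := den_neq0 t r0 h.
  by rewrite exprS exprMn; move: d0; move: (v _ _) => y d0; field.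
by apply: path_continuousM; [exact: cst_path_continuous | exact: coef_cont].
Qed.

Let rem_expand rho zeta F N : 0 < rho -> cabs zeta <= rho / 2 -> path_continuous F ->
  rem rho zeta F 0 = \sum_(n < N) zeta ^+ n * period_int (fun t => F t * (ii * v rho t ^+ n))
     + rem rho zeta F N.
Proof.
move=> r0 h cF; elim: N => [|N IH]; first by rewrite big_ord0 add0r.
by rewrite big_ord_recr /= -addrA -rem_step.
Qed.

Let rem_le rho zeta F N M : 0 < rho -> cabs zeta <= rho / 2 -> path_continuous F ->
  (forall t, cabs (F t) <= M) ->
  cabs (rem rho zeta F N) <= 4 * M * (cabs zeta / rho) ^+ N * (pi *+ 2).
Proof.
move=> r0 h cF FM.
have M0 : 0 <= M := le_trans (cabs_ge0 _) (FM 0).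
apply: le_trans (period_int_le (M := M * (1 * ((cabs zeta / rho) ^+ N * 2))) _ _) _.
- exact: rem_cont.
- move=> t; rewrite cabsM; apply: ler_pM; rewrite ?cabs_ge0 //.
  rewrite cabsM cabs_i !mul1r cabsM; apply: ler_pM; rewrite ?cabs_ge0 //.
    by rewrite cabsX cabsM v_abs.
  rewrite cabsV invf_ple ?posrE ?cabs_gt0 ?den_neq0 //.
  by have := den_ge t r0 h; rewrite mul1r.
by rewrite le_eqVlt; apply/orP; left; apply/eqP; ring.
Qed.

(** The value [2 pi i] of the integral of [dw / w]. *)
Let kappa : Cplx R := ii * cofr (pi *+ 2).

Let kappa_abs : cabs kappa = pi *+ 2.
Proof. by rewrite cabsM cabs_i cabs_cofr mul1r ger0_norm // two_pi_ge0. Qed.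

Let kappa_neq0 : kappa != 0.
Proof. by rewrite -cabs_gt0 kappa_abs two_pi_gt0. Qed.

Let winding_coef rho n : period_int (fun t => 1 * (ii * v rho t ^+ n)) =
  if n is 0%N then kappa else 0.
Proof.
have c1 : path_continuous (fun t => 1 * (ii * v rho t ^+ n)).
  by apply: coef_cont; exact: cst_path_continuous.
case: n c1 => [|n] c1.
  rewrite (period_int_deriv (G := fun t => ii * cofr t) c1).
    by rewrite /kappa [cofr 0]/cofr rmorph0 mulr0 subr0.
  move=> t; apply: path_deriv_eq.
    apply: path_derivM; first exact: path_deriv_cst.
    by apply: path_deriv_cofr; exact: is_derive_id.
  by rewrite mul0r add0r mul1r expr0 /cofr rmorph1.
have dv k t : path_deriv (fun t => v rho t ^+ k) t (- ii * k%:R * v rho t ^+ k).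
  elim: k => [|k IH].
    apply: path_deriv_eq; first exact: path_deriv_cst.
    by rewrite mulr0 mul0r.
  under eq_fun do rewrite exprS.
  apply: path_deriv_eq.
    apply: path_derivM; last exact: IH.
    by apply: path_derivM; [exact: path_deriv_cst | exact: cisV_deriv].
  by rewrite -/(v rho t) /v -natr1 exprS; ring.
rewrite (period_int_deriv (G := fun t => - n.+1%:R^-1 * v rho t ^+ n.+1) c1).
  by rewrite /v cis2pi subrr.
move=> t; apply: path_deriv_eq.
  by apply: path_derivM; [exact: path_deriv_cst | exact: dv].
have n0 : n.+1%:R != 0 :> Cplx R by rewrite pnatr_eq0.
by move: (v rho t ^+ n.+1) => y; field.
Qed.

(** All terms of the geometric series but the constant one have periodic
    primitives, and the remainders tend to 0. *)
Let winding rho zeta : 0 < rho -> cabs zeta <= rho / 2 -> rem rho zeta (fun=> 1) 0 = kappa.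
Proof.
move=> r0 h; apply/eqP; rewrite -subr_eq0 -cabs_eq0 eq_le cabs_ge0 andbT.
have c1 : path_continuous (fun _ : R => 1 : Cplx R) by exact: cst_path_continuous.
have E N : rem rho zeta (fun=> 1) 0 - kappa = rem rho zeta (fun=> 1) N.+1.
  rewrite (rem_expand N.+1 r0 h c1) big_ord_recl /= winding_coef expr0 mul1r.
  rewrite big1 => [|i _]; first by rewrite addr0 addrC addKr.
  by rewrite winding_coef mulr0.
apply/ler_addgt0Pr => e e0; rewrite add0r.
have [N NP] := exists_half_pow_lt (4 * (pi *+ 2)) e0.
rewrite (E N); apply: le_trans (rem_le N.+1 r0 h c1 (M := 1) _) _.
  by move=> t; rewrite cabs1.
apply/ltW/(le_lt_trans _ NP).
have q1 : cabs zeta / rho <= 2^-1 by rewrite ler_pdivrMr // mulrC.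
have q0 : 0 <= cabs zeta / rho by rewrite divr_ge0 ?cabs_ge0 // ltW.
have : (cabs zeta / rho) ^+ N.+1 <= 2^-1 ^+ N.
  apply: le_trans (_ : (cabs zeta / rho) ^+ N <= _).
    by rewrite exprS ler_piMl ?exprn_ge0 // (le_trans q1) // invf_le1 // ler1n.
  by apply: lerXn2r; rewrite ?nnegrE.
by rewrite exprVn mulr1 => hq; rewrite mulrAC ler_pM2l // mulr_gt0 ?two_pi_gt0.
Qed.

(** The coefficients do not depend on [N] and the remainder depends on [f] through
    the bound [M] only. *)
Lemma taylor (f : Cplx R -> Cplx R) (x : Cplx R) (rho M : R) : 0 < rho ->
  (forall w, cabs (w - x) < 2 * rho -> derivable f w 1) ->
  (forall w, cabs (w - x) < 2 * rho -> cabs (f w) <= M) ->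
  exists c : nat -> Cplx R, forall N z, cabs (z - x) <= rho / 2 ->
    cabs (f z - \sum_(n < N) c n * (z - x) ^+ n) <= 4 * M * (cabs (z - x) / rho) ^+ N.
Proof.
move=> r0 df fM.
pose F t := f (x + cofr rho * cis t).
have inb t : cabs (x + cofr rho * cis t - x) < 2 * rho.
  rewrite addrC addKr cabsM cabs_cofr cabs_cis mulr1 ger0_norm ?(ltW r0) //.
  by rewrite mulr_natl mulr2n ltrDl.
have cF : path_continuous F.
  apply: path_continuous_comp => [t|]; first exact/df/inb.
  apply: path_continuousD; first exact: cst_path_continuous.
  apply: path_continuousM; first exact: cst_path_continuous.
  exact: path_deriv_continuous (@cis_deriv R).
exists (fun n => kappa^-1 * period_int (fun t => F t * (ii * v rho t ^+ n))) => N z zx.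
have zrho : cabs (z - x) < rho by apply: le_lt_trans zx _; rewrite ltr_pdivrMr // ltr_pMr // ltr1n.
have r2 : rho < 2 * rho by rewrite ltr_pMl // ltr1n.
have c1 : path_continuous (fun _ : R => 1 : Cplx R) by exact: cst_path_continuous.
have E0 : rem rho (z - x) F 0 = f z * kappa.
  have cr1 := rem_cont 0 r0 zx c1; have crF := rem_cont 0 r0 zx cF.
  rewrite -(winding r0 zx); transitivity (period_int (fun t =>
    f z * (1 * (ii * (((z - x) * v rho t) ^+ 0 / (1 - (z - x) * v rho t)))))); last first.
    exact: period_intZ.
  have cfz := path_continuousM (cst_path_continuous (f z)) cr1.
  apply/eqP; rewrite -subr_eq0 -period_intB //.
  rewrite -[X in _ == X](cauchy_difference_quotient r0 r2 df zrho); apply/eqP.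
  congr period_int; apply/funext => t; have d0 := den_neq0 t r0 zx.
  have rn0 : cofr rho != 0 :> Cplx R by rewrite -cabs_eq0 cabs_cofr normr_eq0 gt_eqF.
  have vE : v rho t = (cofr rho * cis t)^-1.
    by rewrite invfM /v /cofr fmorphV.
  have w0 : cofr rho * cis t != 0 by rewrite mulf_neq0 ?cis_neq0.
  move: d0; rewrite vE -/(F t); move: (cofr rho * cis t) w0 => w w0 d0.
  have d1 : x + w - z != 0.
    have -> : x + w - z = w * (1 - (z - x) / w) by field.
    by rewrite mulf_neq0.
  by rewrite expr0; field; rewrite d1 w0.
have -> : f z - \sum_(n < N) kappa^-1 * period_int (fun t => F t * (ii * v rho t ^+ n)) * (z - x) ^+ n
   = kappa^-1 * rem rho (z - x) F N.
  apply: (mulfI kappa_neq0); rewrite [RHS]mulrA mulfV // mul1r mulrBr [kappa * f z]mulrC -E0.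
  rewrite (rem_expand N r0 zx cF) mulr_sumr.
  rewrite addrAC -sumrB big1 ?add0r // => i _.
  have aux (k q y : Cplx R) : k != 0 -> y * q - k * (k^-1 * q * y) = 0 by move=> k0; field.
  exact: aux.
rewrite cabsM cabsV kappa_abs mulrC ler_pdivrMr ?two_pi_gt0 //.
by apply: rem_le => // t; exact/fM/inb.
Qed.

End taylor.

(** * Local behaviour of holomorphic functions *)
Section local_theory.
Context {R : realType}.
Implicit Types (f : Cplx R -> Cplx R) (x y z w : Cplx R).

Definition holo_bounded f x (r M : R) :=
  forall w, cabs (w - x) < r -> derivable f w 1 /\ cabs (f w) <= M.

Lemma holo_bounded_ge0 f x r M : 0 < r -> holo_bounded f x r M -> 0 <= M.
Proof.
move=> r0 /(_ x); rewrite subrr cabs0 => /(_ r0) [_]; exact/le_trans/cabs_ge0.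
Qed.

Lemma first_order f x rho M : 0 < rho -> holo_bounded f x (2 * rho) M ->
  exists2 d, [/\ has_cderiv f x d, cabs d <= 6 * M / rho &
    forall z, cabs (z - x) <= rho / 2 ->
      cabs (f z - f x - d * (z - x)) <= 4 * M * (cabs (z - x) / rho) ^+ 2] &
  forall z, cabs (z - x) <= rho / 2 -> cabs (f z - f x) <= 4 * M * (cabs (z - x) / rho).
Proof.
move=> r0 fh; have [c cP] := taylor r0 (fun w h => (fh w h).1) (fun w h => (fh w h).2).
have M0 : 0 <= M by apply: holo_bounded_ge0 fh; rewrite mulr_gt0.
have c0 : c 0%N = f x.
  have := cP 1%N x; rewrite subrr cabs0 divr_ge0 ?(ltW r0) // => /(_ isT).
  rewrite big_ord1 expr0 mulr1 mul0r expr1 mulr0 => h; apply/esym/eqP.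
  by rewrite -subr_eq0 -cabs_eq0 eq_le h cabs_ge0.
have P1 z : cabs (z - x) <= rho / 2 -> cabs (f z - f x) <= 4 * M * (cabs (z - x) / rho).
  by move=> /(cP 1%N); rewrite big_ord1 expr0 mulr1 c0 expr1.
have P2 z : cabs (z - x) <= rho / 2 ->
    cabs (f z - f x - c 1%N * (z - x)) <= 4 * M * (cabs (z - x) / rho) ^+ 2.
  by move=> /(cP 2%N); rewrite big_ord_recl big_ord1 /= expr0 mulr1 c0 /bump /= expr1 opprD addrA.
exists (c 1%N) => //; split=> //.
  apply: (@has_cderiv_quadratic _ f x _ (rho / 2) (4 * M / rho ^+ 2)).
  - by rewrite divr_gt0.
  - by apply: divr_ge0; [exact: mulr_ge0 | exact/exprn_ge0/ltW].
  - by move=> z /P2; rewrite expr_div_n mulrA mulrAC.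
pose z := x + cofr (rho / 2).
have zE : z - x = cofr (rho / 2) by rewrite /z addrC addKr.
have za : cabs (z - x) = rho / 2 by rewrite zE cabs_cofr ger0_norm // divr_ge0 // ltW.
have := P1 z; have := P2 z; rewrite za lexx => /(_ isT) h2 /(_ isT) h1.
have : cabs (c 1%N * (z - x)) <= 3 * M.
  have -> : c 1%N * (z - x) = (f z - f x) - (f z - f x - c 1%N * (z - x)) by ring.
  apply: le_trans (cabsD _ _) _; rewrite cabsN; apply: le_trans (lerD h1 h2) _.
  by rewrite le_eqVlt; apply/orP; left; apply/eqP; field; rewrite gt_eqF.
by rewrite cabsM za -ler_pdivlMr ?divr_gt0 // => /le_trans; apply;
  rewrite le_eqVlt; apply/orP; left; apply/eqP; field; rewrite gt_eqF.
Qed.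

Lemma pow_small_le0 (a C : R) : (forall N, a <= C * 2^-1 ^+ N.+1) -> a <= 0.
Proof.
move=> h; apply/ler_addgt0Pr => e e0; rewrite add0r.
have [N NP] := exists_half_pow_lt `|C| e0.
apply: le_trans (h N) _; apply/ltW/(le_lt_trans _ NP).
apply: le_trans (_ : `|C| * 2^-1 ^+ N.+1 <= _).
  by rewrite ler_wpM2r ?exprn_ge0 ?invr_ge0 // ler_norm.
rewrite -exprVn ler_wpM2l // exprS ler_piMl ?exprn_ge0 ?invr_ge0 //.
by rewrite invf_le1 // ler1n.
Qed.

(** For [c != 0] the value [f x] is taken with multiplicity [k.+1] at [x]; the
    radius [rho / 2] is the one on which the Taylor remainder is controlled. *)
Definition has_order f x (rho : R) (k : nat) (c : Cplx R) (C : R) :=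
  forall z, cabs (z - x) <= rho / 2 ->
    cabs (f z - f x - c * (z - x) ^+ k.+1) <= C * cabs (z - x) ^+ k.+2.

(** If all Taylor coefficients of positive degree vanish, the remainders, which
    tend to 0, bound [f z - f x]; otherwise the first nonzero one gives the
    multiplicity. *)
Lemma order_dichotomy f x rho M : 0 < rho -> holo_bounded f x (2 * rho) M ->
  (forall z, cabs (z - x) <= rho / 2 -> f z = f x) \/
  (exists k c C, [/\ c != 0, 0 <= C & has_order f x rho k c C]).
Proof.
move=> r0 fh; have [c cP] := taylor r0 (fun w h => (fh w h).1) (fun w h => (fh w h).2).
have M0 : 0 <= M by apply: holo_bounded_ge0 fh; rewrite mulr_gt0.
have c0 : c 0%N = f x.
  have := cP 1%N x; rewrite subrr cabs0 divr_ge0 ?(ltW r0) // => /(_ isT).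
  rewrite big_ord1 expr0 mulr1 mul0r expr1 mulr0 => h; apply/esym/eqP.
  by rewrite -subr_eq0 -cabs_eq0 eq_le h cabs_ge0.
have [ex|nex] := pselect (exists n, c n.+1 != 0); last first.
  have cn n : c n.+1 = 0 by apply/eqP/negP => /negP ?; apply: nex; exists n.
  left=> z zx; apply/eqP; rewrite -subr_eq0 -cabs_eq0 eq_le cabs_ge0 andbT.
  apply: (@pow_small_le0 _ (4 * M)) => N; have := cP N.+1 z zx.
  rewrite big_ord_recl expr0 mulr1 c0 big1 => [|i _]; last by rewrite cn mul0r.
  rewrite addr0 => /le_trans; apply; rewrite ler_wpM2l ?mulr_ge0 //.
  by apply: lerXn2r; rewrite ?nnegrE ?divr_ge0 ?cabs_ge0 ?invr_ge0 // ?(ltW r0) //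
    ler_pdivrMr // mulrC.
right; case: (ex_minnP ex) => k ck kmin; exists k, (c k.+1), (4 * M / rho ^+ k.+2); split=> //.
  by apply: divr_ge0; [exact: mulr_ge0 | exact/exprn_ge0/ltW].
move=> z zx; have := cP k.+2 z zx.
rewrite big_ord_recl big_ord_recr /= expr0 mulr1 c0 big1 => [|i _]; last first.
  have -> : c (bump 0 i) = 0; last by rewrite mul0r.
  by apply/eqP; case: eqP => // /eqP /kmin; rewrite leqNgt ltn_ord.
rewrite add0r /bump /= add1n opprD addrA => /le_trans; apply.
by rewrite expr_div_n mulrCA mulrC mulrA.
Qed.

(** Take for [u] a root of [u ^+ k.+1 = f x / c]: along it the leading term is a
    positive multiple of [f x], so the modulus increases.  This plays the part of
    the maximum principle, and in addition gives a segment on which [|f|] exceeds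
    [|f x|]. *)
Lemma has_order_escape f x rho k c C : 0 < rho -> c != 0 -> 0 <= C ->
  has_order f x rho k c C -> f x != 0 ->
  exists u, exists2 t0, 0 < t0 & forall t, 0 < t -> t < t0 ->
    cabs (f x) < cabs (f (x + cofr t * u)).
Proof.
move=> r0 cn0 C0 fo fx0; pose u := k.+1.-root (f x / c).
have uk : u ^+ k.+1 = f x / c by rewrite rootCK.
have u0 : 0 <= cabs u := cabs_ge0 _.
pose C' := C * cabs u ^+ k.+2.
have C'0 : 0 <= C' by apply: mulr_ge0 => //; exact: exprn_ge0.
have fxp : 0 < cabs (f x) by rewrite cabs_gt0.
exists u, (Num.min (rho / 2 / (cabs u + 1)) (cabs (f x) / (C' + 1))).
  by rewrite lt_min !divr_gt0 // ltr_wpDl.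
move=> t t0; rewrite lt_min !ltr_pdivlMr ?ltr_wpDl // => /andP [t1 t2].
have zE : x + cofr t * u - x = cofr t * u by rewrite addrC addKr.
have za : cabs (cofr t * u) = t * cabs u by rewrite cabsM cabs_cofr ger0_norm // ltW.
have := fo (x + cofr t * u); rewrite zE za => /(_ _) h.
have {}h : cabs (f (x + cofr t * u) - f x - c * (cofr t * u) ^+ k.+1) <= C * (t * cabs u) ^+ k.+2.
  by apply: h; nra.
have E : c * (cofr t * u) ^+ k.+1 = cofr (t ^+ k.+1) * f x.
  rewrite exprMn uk /cofr rmorphXn /=; field; exact: cn0.
rewrite E in h.
have tk0 : 0 < t ^+ k.+1 by rewrite exprn_gt0.
have h1 : C * (t * cabs u) ^+ k.+2 < t ^+ k.+1 * cabs (f x).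
  have -> : C * (t * cabs u) ^+ k.+2 = t ^+ k.+1 * (t * C').
    by rewrite exprMn /C' [t ^+ k.+2]exprS; ring.
  by rewrite ltr_pM2l //; lra.
have h2 : cabs ((1 + cofr (t ^+ k.+1)) * f x) = (1 + t ^+ k.+1) * cabs (f x).
  have -> : 1 + cofr (t ^+ k.+1) = cofr (1 + t ^+ k.+1) :> Cplx R.
    by rewrite /cofr rmorphD rmorph1.
  by rewrite cabsM cabs_cofr ger0_norm // addr_ge0 // ltW.
have := cabsB ((1 + cofr (t ^+ k.+1)) * f x) (f (x + cofr t * u)).
rewrite h2 cdistrC.
have -> : f (x + cofr t * u) - (1 + cofr (t ^+ k.+1)) * f x =
  f (x + cofr t * u) - f x - cofr (t ^+ k.+1) * f x by ring.
by lra.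
Qed.

Lemma has_cderiv_pow x y k :
  has_cderiv (fun w => (w - x) ^+ k.+1) y (k.+1%:R * (y - x) ^+ k).
Proof.
apply/has_cderivP; have dB : is_derive y 1 (fun w => w - x) 1.
  by apply: is_derive_eq; rewrite subr0.
have h := @is_deriveX _ _ (fun w => w - x) k.+1 y 1 1 dB.
have -> : (fun w => (w - x) ^+ k.+1) = (fun w => w - x) ^+ k.+1.
  by apply/funext => w; rewrite fctE.
by apply: (is_derive_eq h); rewrite /GRing.scale /= mulr1.
Qed.

(** Apply the derivative bound of [first_order] to [f w - f x - c (w - x) ^+ k.+1]
    on the disc of radius [|y - x|] about [y].  If [f' y = 0], it says that
    [|c| (k + 1) |y - x| ^+ k] is at most a constant times [|y - x| ^+ k.+1],
    which fails for [y] near [x]. *)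
Lemma isolated_critical f x rho M k c C : 0 < rho -> holo_bounded f x (2 * rho) M ->
  c != 0 -> 0 <= C -> has_order f x rho k c C ->
  exists2 eta, 0 < eta & forall y d, 0 < cabs (y - x) -> cabs (y - x) <= eta ->
    has_cderiv f y d -> d != 0.
Proof.
move=> r0 fh c0 C0 fo; pose K := 12 * C * 2 ^+ k.+2.
have K0 : 0 <= K by apply: mulr_ge0; [exact: mulr_ge0 | exact: exprn_ge0].
have ca : 0 < cabs c by rewrite cabs_gt0.
exists (Num.min (rho / 4) (cabs c / (2 * (K + 1)))).
  by rewrite lt_min !divr_gt0 // mulr_gt0 // ltr_wpDl.
move=> y d; set s := cabs (y - x) => s0; rewrite le_min => /andP [s1 s2] fd.
apply/negP => /eqP d0; rewrite {}d0 in fd.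
pose F w := f w - f x - c * (w - x) ^+ k.+1.
have inr w : cabs (w - y) < 2 * (s / 2) -> cabs (w - x) <= 2 * s.
  move=> wy; apply: le_trans (cabs_tri y _ _) _; rewrite -/s.
  have E : 2 * (s / 2) = s by rewrite mulrCA mulfV // mulr1.
  by rewrite E in wy; lra.
have dpow w : derivable (fun w => c * (w - x) ^+ k.+1) w 1.
  apply: derivableM; first exact: derivable_cst.
  by apply/derivable_cderiv; eexists; exact: has_cderiv_pow.
have Fh : holo_bounded F y (2 * (s / 2)) (C * (2 * s) ^+ k.+2).
  move=> w /inr wx; split.
    apply: derivableB; last exact: dpow.
    apply: derivableB; last exact: derivable_cst.
    by apply: (fh w _).1; lra.
  apply: le_trans (fo w _) _; first lra.
  by rewrite ler_wpM2l // lerXn2r ?nnegrE ?cabs_ge0 // mulr_ge0 // ltW.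
have [d' [Fd d'le _] _] := first_order (divr_gt0 s0 (ltr0n _ 2)) Fh.
have Fd2 : has_cderiv F y (0 - 0 - c * (k.+1%:R * (y - x) ^+ k)).
  have /has_cderivP fd' := fd; have /has_cderivP pd := has_cderiv_pow x y k.
  by apply/has_cderivP; apply: is_deriveB.
rewrite -(has_cderiv_unique Fd2 Fd) subrr sub0r cabsN !cabsM cabsX -/s in d'le.
have kk : 1 <= cabs (k.+1%:R : Cplx R).
  have -> : k.+1%:R = cofr (k.+1%:R) :> Cplx R by rewrite /cofr rmorph_nat.
  by rewrite cabs_cofr ger0_norm ?ler1n // ler0n.
have sk : 0 < s ^+ k by rewrite exprn_gt0.
have : cabs c * s ^+ k <= (K * s) * s ^+ k.
  apply: le_trans (_ : cabs c * (cabs (k.+1%:R : Cplx R) * s ^+ k) <= _).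
    by rewrite ler_wpM2l ?(ltW ca) // ler_peMl // ltW.
  apply: le_trans d'le _; rewrite le_eqVlt; apply/orP; left; apply/eqP.
  by rewrite /K exprMn ![_ ^+ k.+2]exprS ![_ ^+ k.+1]exprS; field; rewrite gt_eqF.
rewrite ler_pM2r // => h.
move: s2; rewrite ler_pdivlMr ?mulr_gt0 ?ltr_wpDl // => s2.
by have := s0; nra.
Qed.

End local_theory.

(** * The identity theorem *)
Section identity.
Context {R : realType}.
Implicit Types (D : set (Cplx R)) (f : Cplx R -> Cplx R) (x y z w p : Cplx R).

Lemma open_disc D z : open D -> D z ->
  exists2 rho : R, 0 < rho & forall w, cabs (w - z) < 2 * rho -> D w.
Proof.
move=> /open_cabs oD /oD [e e0 eD]; exists (e / 2); first by rewrite divr_gt0.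
by move=> w; rewrite mulrCA mulfV // mulr1; exact: eD.
Qed.

Lemma has_order_near_neq f x rho k c C : 0 < rho -> c != 0 -> 0 <= C ->
  has_order f x rho k c C ->
  exists2 eta : R, 0 < eta & forall w, 0 < cabs (w - x) -> cabs (w - x) < eta -> f w != f x.
Proof.
move=> r0 c0 C0 fo; have ca : 0 < cabs c by rewrite cabs_gt0.
exists (Num.min (rho / 2) (cabs c / (C + 1))).
  by rewrite lt_min !divr_gt0 // ltr_wpDl.
move=> w w0; rewrite lt_min => /andP [/ltW w1]; rewrite ltr_pdivlMr ?ltr_wpDl // => w2.
apply/negP => /eqP E; have := fo w w1; rewrite E subrr sub0r cabsN cabsM cabsX.
have wk : 0 < cabs (w - x) ^+ k.+1 by rewrite exprn_gt0.
by rewrite [_ ^+ k.+2]exprS mulrA ler_pM2r //; nra.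
Qed.

(** The set of points near which [f] is constantly [f x] is open, and it is closed
    in [D] because a value of finite multiplicity is isolated. *)
Theorem identity_theorem D f (M : R) x p : open D -> connected D ->
  (forall z, D z -> derivable f z 1 /\ cabs (f z) <= M) ->
  D x -> D p -> (exists2 e : R, 0 < e & forall w, cabs (w - x) < e -> f w = f x) ->
  f p = f x.
Proof.
move=> oD cD fD Dx Dp xc.
pose B := [set z | D z /\ exists2 e : R, 0 < e & forall w, cabs (w - z) < e -> f w = f x].
have BD : B `<=` D by move=> z [].
have oB : open B.
  apply/open_cabs => z [/(open_disc oD) [rho r0 rD] [e e0 eP]].
  exists (Num.min rho (e / 2)); first by rewrite lt_min r0 divr_gt0.
  move=> w; rewrite lt_min => /andP [w1 w2]; split; first by apply: rD; lra.
  exists (e / 2); first by rewrite divr_gt0.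
  move=> v vw; apply: eP; apply: le_lt_trans (cabs_tri w _ _) _.
  by rewrite (splitr e) ltrD.
suff BE : B = D.
  have [_ [e e0 eP]] : B p by rewrite BE.
  by rewrite eP // subrr cabs0.
apply: cD.
- by exists x; split.
- by exists B => //; rewrite setIidr.
exists (closure B); first exact: closed_closure.
rewrite eqEsubset; split=> [z Bz|z [Dz /closure_cabs cBz]].
  by split; [exact: BD | exact: subset_closure].
split=> //; have [rho r0 rD] := open_disc oD Dz.
have fh : holo_bounded f z (2 * rho) M by move=> w /rD /fD.
have [h|[k [c [C [c0 C0 fo]]]]] := order_dichotomy r0 fh.
  have [w [Dw [e e0 eP]] wz] := cBz (rho / 2) (divr_gt0 r0 (ltr0n _ 2)).
  have fxz : f z = f x.
    by rewrite -(h w (ltW wz)); apply: eP; rewrite subrr cabs0.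
  exists (rho / 2); first by rewrite divr_gt0.
  by move=> v /ltW /h ->.
exfalso; have [eta eta0 etaP] := has_order_near_neq r0 c0 C0 fo.
have [fxz|fxz] := eqVneq (f x) (f z).
  have [w [Dw [e e0 eP]] wz] := cBz eta eta0.
  have [wz0|wz0] := eqVneq w z; last first.
    have := etaP w; rewrite cabs_gt0 subr_eq0 => /(_ wz0 wz) /eqP; apply.
    by rewrite -fxz; apply: eP; rewrite subrr cabs0.
  pose h : R := Num.min (e / 2) (eta / 2).
  have h0 : 0 < h by rewrite lt_min !divr_gt0.
  have he : h < e by rewrite gt_min; apply/orP; left; rewrite ltr_pdivrMr // ltr_pMr // ltr1n.
  have hh : h < eta by rewrite gt_min; apply/orP; right; rewrite ltr_pdivrMr // ltr_pMr // ltr1n.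
  have := etaP (z + cofr h); rewrite addrC addKr cabs_cofr ger0_norm ?(ltW h0) //.
  move=> /(_ h0 hh) /eqP; apply; rewrite -fxz; apply: eP.
  by rewrite wz0 addrC addKr cabs_cofr ger0_norm // ltW.
have [l fl] := (derivable_cderiv _ _).1 (fD z Dz).1.
have fxz0 : 0 < cabs (f x - f z) by rewrite cabs_gt0 subr_eq0.
have [d d0 dP] := has_cderiv_continuous fl fxz0.
have [w [Dw [e e0 eP]] wz] := cBz d d0.
by have := dP w wz; rewrite eP ?ltxx // subrr cabs0.
Qed.

End identity.

(** * Limits along ultrafilters and normal families *)

(** Along an ultrafilter all bounded families converge simultaneously, which saves
    the extraction of subsequences. *)
Definition ulim (R : realType) (T : Type) (F : set_system T) (u : T -> Cplx R) (l : Cplx R) :=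
  forall e : R, 0 < e -> F [set j | cabs (u j - l) < e].

Section ultralimits.
Context {R : realType} {T : Type} (F : set_system T) {UF : UltraFilter F}.
Implicit Types (u v : T -> Cplx R) (l z : Cplx R).

Lemma ulim_compact u (A : set (Cplx R)) : compact A -> F [set j | A (u j)] ->
  exists2 l, A l & ulim F u l.
Proof.
move=> + FA => /(_ (u @ F) _ FA) [l [Al lF]]; exists l => // e e0.
have [//|FC] := in_ultra_setVsetC [set j | cabs (u j - l) < e] UF.
have : nbhs l [set w | cabs (w - l) < e] by apply/nbhs_cabs; exists e.
by move=> /(lF [set w | ~ cabs (w - l) < e] _ FC) [w []].
Qed.

Lemma ulim_exists u (M : R) : F [set j | cabs (u j) <= M] -> exists l, ulim F u l.
Proof.
move=> FM; have [|l _ lu] := @ulim_compact u _ (@compact_cdisc R 0 M); last by exists l.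
by apply: filterS FM => j /=; rewrite subr0.
Qed.

Lemma ulim_cst l : ulim F (fun=> l) l.
Proof. by move=> e e0; apply: filterE => j /=; rewrite subrr cabs0. Qed.

Lemma ulimB u v l l' : ulim F u l -> ulim F v l' -> ulim F (fun j => u j - v j) (l - l').
Proof.
move=> h h' e e0; have e2 : 0 < e / 2 by rewrite divr_gt0.
apply: filterS2 (h _ e2) (h' _ e2) => j /= h1 h2.
have -> : u j - v j - (l - l') = (u j - l) - (v j - l') by ring.
by apply: le_lt_trans (cabsD _ _) _; rewrite cabsN (splitr e) ltrD.
Qed.

Lemma ulimM u l z : ulim F u l -> ulim F (fun j => u j * z) (l * z).
Proof.
move=> h e e0; have z0 : 0 < cabs z + 1 by rewrite ltr_wpDl ?cabs_ge0.
apply: filterS (h _ (divr_gt0 e0 z0)) => j /=; rewrite ltr_pdivlMr // => h1.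
rewrite -mulrBl cabsM; apply: le_lt_trans h1.
by rewrite ler_wpM2l ?cabs_ge0 // lerDl.
Qed.

Lemma ulim_le u l (a : R) : ulim F u l -> F [set j | cabs (u j) <= a] -> cabs l <= a.
Proof.
move=> h ha; apply/ler_addgt0Pr => e e0.
have [j [/= h1 h2]] := filter_ex (filterI (h _ e0) ha).
rewrite -[l](subKr (u j)); apply: le_trans (cabsD _ _) _; rewrite cabsN.
by apply: lerD => //; exact: ltW.
Qed.

Lemma ulim_ge u l (a : R) : ulim F u l -> F [set j | a <= cabs (u j)] -> a <= cabs l.
Proof.
move=> h ha; apply/ler_addgt0Pr => e e0.
have [j [/= h1 h2]] := filter_ex (filterI (h _ e0) ha).
apply: le_trans h2 _; rewrite -[u j](subrK l); apply: le_trans (cabsD _ _) _.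
by rewrite addrC lerD2l ltW.
Qed.

Lemma ulim_unique u l l' : ulim F u l -> ulim F u l' -> l = l'.
Proof.
move=> h h'; apply/eqP; rewrite -subr_eq0 -cabs_eq0 eq_le cabs_ge0 andbT.
apply: (ulim_le (ulimB h h')); apply: filterE => j /=; by rewrite subrr cabs0.
Qed.

End ultralimits.

(** A pointwise limit of maps to the open disk might take values of modulus 1; the
    bound by [m], in contrast, passes to the limit. *)
Definition dominated (R : realType) (D : set (Cplx R)) (p : Cplx R)
    (m : Cplx R -> R) : set (Cplx R -> Cplx R) :=
  [set f | (forall z, D z -> derivable f z 1 /\ cabs (f z) <= m z) /\ f p = 0].

Section dominated.
Context {R : realType} (D : set (Cplx R)) (p : Cplx R) (m : Cplx R -> R).
Hypotheses (oD : open D) (Dp : D p) (m1 : forall z, D z -> m z <= 1).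

Lemma dominated_holo_bounded f z rho : dominated D p m f ->
  (forall w, cabs (w - z) < 2 * rho -> D w) -> holo_bounded f z (2 * rho) 1.
Proof.
move=> [fD _] rD w /rD Dw; have [df fm] := fD w Dw; split=> //.
exact: le_trans fm (m1 Dw).
Qed.

Lemma dominated_first_order f x rho : dominated D p m f -> 0 < rho ->
  (forall w, cabs (w - x) < 2 * rho -> D w) ->
  exists2 d, [/\ has_cderiv f x d, cabs d <= 6 / rho &
    forall z, cabs (z - x) <= rho / 2 ->
      cabs (f z - f x - d * (z - x)) <= 4 * (cabs (z - x) / rho) ^+ 2] &
  forall z, cabs (z - x) <= rho / 2 -> cabs (f z - f x) <= 4 / rho * cabs (z - x).
Proof.
move=> fE r0 rD.
have [d [fd d6 f2] f1] := first_order r0 (dominated_holo_bounded fE rD).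
rewrite !mulr1 in d6 f1 f2; exists d; first by split.
by move=> z /f1; rewrite mulrA mulrAC.
Qed.

(** Montel's theorem: the derivatives at a point stay bounded and the second-order
    estimate is uniform, so the pointwise limit is differentiable. *)
Lemma dominated_compact (T : Type) (F : set_system T) (UF : UltraFilter F)
    (f : T -> Cplx R -> Cplx R) : (forall j, dominated D p m (f j)) ->
  exists2 g, dominated D p m g & forall z, D z -> ulim F (fun j => f j z) (g z).
Proof.
move=> fE.
have [g gP] : exists g : Cplx R -> Cplx R, forall z, D z -> ulim F (fun j => f j z) (g z).
  have h z : exists l, D z -> ulim F (fun j => f j z) l.
    have [Dz|nDz] := pselect (D z); last by exists 0.
    have [|l lP] := @ulim_exists _ _ F UF (fun j => f j z) 1; last by exists l.
    by apply: filterE => j /=; apply: le_trans ((fE j).1 z Dz).2 _; exact: m1.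
  by have [g gP] := choice h; exists g.
exists g => //; split; last first.
  apply: (@ulim_unique _ _ F UF (fun j => f j p)); first exact: gP.
  have -> : (fun j => f j p) = (fun=> 0) by apply/funext => j; exact: (fE j).2.
  exact: ulim_cst.
move=> z Dz; split; last first.
  by apply: (ulim_le (gP z Dz)); apply: filterE => j /=; exact: ((fE j).1 z Dz).2.
have [rho r0 rD] := open_disc oD Dz.
have dj j : exists d, cabs d <= 6 / rho /\
    forall w, cabs (w - z) <= rho / 2 ->
      cabs (f j w - f j z - d * (w - z)) <= 4 * (cabs (w - z) / rho) ^+ 2.
  have [d [_ h1 h2] _] := dominated_first_order (fE j) r0 rD.
  by exists d.
have [d dP] := choice dj.
have [|l dl] := @ulim_exists _ _ F UF d (6 / rho).
  by apply: filterE => j; exact: (dP j).1.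
apply/derivable_cderiv; exists l.
apply: (@has_cderiv_quadratic _ g z l (rho / 2) (4 / rho ^+ 2)).
- by rewrite divr_gt0.
- by rewrite divr_ge0 // exprn_ge0 // ltW.
move=> w w1; have Dw : D w by apply: rD; lra.
rewrite mulrAC -mulrA -expr_div_n.
apply: (ulim_le (ulimB (ulimB (gP w Dw) (gP z Dz)) (ulimM (w - z) dl))).
by apply: filterE => j; exact: (dP j).2.
Qed.

End dominated.

(** * The Moebius form of the Caratheodory distance *)
Definition normalized_maps (R : realType) (D : set (Cplx R)) (p : Cplx R)
    : set (Cplx R -> Cplx R) :=
  [set g | (forall z, D z -> derivable g z 1 /\ cabs (g z) < 1) /\ g p = 0].

(** The hyperbolic tangent of the Caratheodory pseudodistance; see
    [caratheodory_ballE]. *)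
Definition moebius_caratheodory (R : realType) (D : set (Cplx R)) (p q : Cplx R) : R :=
  sup [set cabs (g q) | g in normalized_maps D p].

Section moebius_caratheodory.
Context {R : realType} (D : set (Cplx R)) (p : Cplx R).
Hypotheses (oD : open D) (Dp : D p).
Implicit Types (q z w : Cplx R) (g f : Cplx R -> Cplx R).
Local Notation mc := (moebius_caratheodory D p).

Lemma normalized_maps0 : normalized_maps D p (fun=> 0).
Proof.
by split=> // z _; split; [exact: derivable_cst | rewrite cabs0 ltr01].
Qed.

Lemma mc_ub g q : D q -> normalized_maps D p g -> cabs (g q) <= mc q.
Proof.
move=> Dq Ng; apply: ub_le_sup; last by exists g.
by exists 1 => _ [h Nh <-]; apply/ltW; exact: (Nh.1 q Dq).2.
Qed.

Lemma mc_lub q (a : R) : (forall g, normalized_maps D p g -> cabs (g q) <= a) -> mc q <= a.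
Proof.
move=> h; apply: ge_sup; last by move=> _ [g Ng <-]; exact: h.
by exists (cabs (0 : Cplx R)), (fun=> 0) => //; exact: normalized_maps0.
Qed.

Lemma mc_le1 q : D q -> mc q <= 1.
Proof. by move=> Dq; apply: mc_lub => g Ng; apply/ltW; exact: (Ng.1 q Dq).2. Qed.

Lemma mc_ge0 q : D q -> 0 <= mc q.
Proof. by move=> Dq; apply: le_trans (mc_ub Dq normalized_maps0); rewrite cabs0. Qed.

Lemma normalized_dominated g : normalized_maps D p g -> dominated D p mc g.
Proof.
move=> Ng; split; last exact: Ng.2.
by move=> z Dz; split; [exact: (Ng.1 z Dz).1 | exact: mc_ub].
Qed.

(** All the functions in the supremum satisfy the same Lipschitz estimate. *)
Lemma mc_lipschitz x rho z : 0 < rho -> (forall w, cabs (w - x) < 2 * rho -> D w) ->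
  cabs (z - x) <= rho / 2 -> `|mc z - mc x| <= 4 / rho * cabs (z - x).
Proof.
move=> r0 rD zx.
have Dx : D x by apply: rD; rewrite subrr cabs0 mulr_gt0.
have Dz : D z by apply: rD; lra.
have lip g : normalized_maps D p g -> cabs (g z - g x) <= 4 / rho * cabs (z - x).
  move=> Ng; have gE := normalized_dominated Ng.
  by have [d _ gl] := dominated_first_order mc_le1 gE r0 rD; exact: gl.
apply/ler_normlP; split.
  rewrite opprB lerBlDr; apply: mc_lub => g Ng; have := lip g Ng; have := mc_ub Dz Ng.
  by have := cabsB (g x) (g z); rewrite [cabs (g x - g z)]cdistrC; lra.
rewrite lerBlDr; apply: mc_lub => g Ng; have := lip g Ng; have := mc_ub Dx Ng.
by have := cabsB (g z) (g x); lra.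
Qed.

Lemma mc_extremal q : D q -> exists2 f, dominated D p mc f & cabs (f q) = mc q.
Proof.
move=> Dq.
have near n : exists g, normalized_maps D p g /\ mc q - n.+1%:R^-1 < cabs (g q).
  have hs : has_sup [set cabs (g q) | g in normalized_maps D p].
    split; first by exists (cabs (0 : Cplx R)), (fun=> 0) => //; exact: normalized_maps0.
    by exists 1 => _ [h Nh <-]; apply/ltW; exact: (Nh.1 q Dq).2.
  have n0 : 0 < n.+1%:R^-1 :> R by rewrite invr_gt0.
  by have [_ [g Ng <-] h] := sup_adherent n0 hs; exists g.
have [g gP] := choice near.
have [F [UF nF]] := @ultraFilterLemma nat \oo _.
have [f fE fl] := dominated_compact oD Dp mc_le1 UF (fun j => normalized_dominated (gP j).1).
exists f => //; apply/eqP; rewrite eq_le ((fE.1 q Dq).2) /=.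
apply/ler_addgt0Pr => e e0; rewrite -lerBlDr.
apply: (ulim_ge (fl q Dq)); apply: nF.
have [N NP] : exists N : nat, e^-1 < N%:R.
  by exists (Num.bound e^-1); rewrite archi_boundP // invr_ge0 ltW.
exists N => // n /= Nn; apply/ltW; apply: le_lt_trans (gP n).2.
rewrite lerB // ltW // invf_plt ?posrE //; apply: lt_le_trans NP _.
by rewrite ler_nat (leq_trans Nn).
Qed.

End moebius_caratheodory.

Section ball.
Context {R : realType}.
Implicit Types (D : set (Cplx R)) (p q z w a b : Cplx R) (t : R).

Definition artanhR t : R := 2^-1 * ln ((1 + t) / (1 - t)).
Definition tanhR (r : R) : R := (expR (2 * r) - 1) / (expR (2 * r) + 1).

Lemma tanhR_gt0 r : 0 < r -> 0 < tanhR r.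
Proof.
move=> r0; have e0 := expR_gt0 (2 * r).
by rewrite divr_gt0 ?subr_gt0 ?expR_gt1 ?mulr_gt0 // addr_gt0.
Qed.

Lemma tanhR_lt1 r : tanhR r < 1.
Proof. by rewrite ltr_pdivrMr ?addr_gt0 ?expR_gt0 //; lra. Qed.

Lemma artanhR_lt t r : 0 <= t -> t < 1 -> (artanhR t < r) = (t < tanhR r).
Proof.
move=> t0 t1; have e0 := expR_gt0 (2 * r).
have d1 : 0 < 1 - t by rewrite subr_gt0.
have -> : (artanhR t < r) = (ln ((1 + t) / (1 - t)) < ln (expR (2 * r))).
  by rewrite expRK /artanhR; apply/idP/idP; lra.
rewrite ltr_ln ?posrE //; last first.
  by apply: divr_gt0 => //; lra.
by rewrite ltr_pdivrMr // /tanhR ltr_pdivlMr ?addr_gt0 //; apply/idP/idP; lra.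
Qed.

Lemma artanhR_le t t' : 0 <= t -> t <= t' -> t' < 1 -> artanhR t <= artanhR t'.
Proof.
move=> t0 tt t1; have d1 : 0 < 1 - t by lra.
have d2 : 0 < 1 - t' by lra.
have n1 : 0 < 1 + t by lra.
have n2 : 0 < 1 + t' by lra.
rewrite /artanhR ler_pM2l ?invr_gt0 // ler_ln ?posrE ?divr_gt0 //.
by rewrite ler_pdivrMr // mulrAC ler_pdivlMr //; lra.
Qed.

Lemma poincare_distE z w : poincare_dist z w = artanhR (cabs ((z - w) / (1 - z * w^* ))).
Proof. by []. Qed.

Lemma norm_lt1 z : (`|z| < 1) = (cabs z < 1).
Proof. by rewrite cabsE ltcE /= eqxx. Qed.

Lemma cabs_conj z : cabs z^* = cabs z.
Proof. by case: z => a b; rewrite /cabs /= sqrrN. Qed.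

Lemma cabs_sqr z : cabs z ^+ 2 = complex.Re z ^+ 2 + complex.Im z ^+ 2.
Proof. by case: z => a b; rewrite /cabs /= sqr_sqrtr // addr_ge0 ?sqr_ge0. Qed.

Lemma moebius_lt1 a b : cabs a < 1 -> cabs b < 1 ->
  1 - a^* * b != 0 /\ cabs ((a - b) / (1 - a^* * b)) < 1.
Proof.
move=> a1 b1; have a0 := cabs_ge0 a; have b0 := cabs_ge0 b.
have d0 : 1 - a^* * b != 0.
  rewrite subr_eq0; apply/negP => /eqP E.
  by have := @cabs1 R; rewrite E cabsM cabs_conj; nra.
split=> //; have dp : 0 < cabs (1 - a^* * b) by rewrite cabs_gt0.
rewrite cabsM cabsV ltr_pdivrMr // mul1r -(ltr_pXn2r (ltn0Sn 1)) ?nnegrE ?cabs_ge0 //.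
have : 0 < (1 - cabs a ^+ 2) * (1 - cabs b ^+ 2) by apply: mulr_gt0; nra.
rewrite !cabs_sqr ReB ImB ReB ImB.
have -> : complex.Re (a^* * b) = complex.Re a * complex.Re b + complex.Im a * complex.Im b.
  by case: (a) (b) => a1' a2' [b1' b2'] /=; ring.
have -> : complex.Im (a^* * b) = complex.Re a * complex.Im b - complex.Im a * complex.Re b.
  by case: (a) (b) => a1' a2' [b1' b2'] /=; ring.
by rewrite /=; nra.
Qed.

Lemma cabs_moebiusC a b : cabs ((a - b) / (1 - a * b^* )) = cabs ((a - b) / (1 - a^* * b)).
Proof.
have -> : 1 - a^* * b = (1 - a * b^* )^*.
  by case: (a) (b) => a1 a2 [b1 b2]; apply: cplx_eq => /=; ring.
by rewrite !cabsM !cabsV cabs_conj.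
Qed.

(** Each competitor [f] of the pseudodistance can be followed by the Moebius map
    that sends [f p] to 0, which leaves the distance of [f p] and [f q]
    unchanged. *)
Lemma caratheodory_ballE D p r q : open D -> D p ->
  caratheodory_ball D p r q <-> D q /\ moebius_caratheodory D p q < tanhR r.
Proof.
move=> oD Dp; split=> -[Dq h]; split=> //.
  set S := [set (poincare_dist (f p) (f q))%:E | f in holo_to_disk D] in h.
  have ub g : normalized_maps D p g ->
      ((artanhR (cabs (g q)))%:E <= caratheodory D p q)%E.
    move=> Ng; apply: ereal_sup_ubound; exists g.
      by move=> z Dz; have [dg g1] := Ng.1 z Dz; split=> //; rewrite norm_lt1.
    by rewrite poincare_distE Ng.2 mul0r subr0 divr1 sub0r cabsN.
  have ub0 := ub _ (normalized_maps0 D p).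
  have [c cE] : exists c, caratheodory D p q = c%:E.
    move: h ub0; case: (caratheodory D p q) => [c|//|//] _ _; by exists c.
  rewrite cE lte_fin in h.
  (* A radius strictly between the distance and [r] keeps the inequality strict
     after passing to the supremum. *)
pose c' := (c + r) / 2; have cc' : c < c' by rewrite /c' ltr_pdivlMr //; lra.
  have c'r : c' < r by rewrite /c' ltr_pdivrMr //; lra.
  apply: le_lt_trans (_ : tanhR c' < _).
    apply: mc_lub => g Ng; apply/ltW; rewrite -artanhR_lt ?cabs_ge0 //; last first.
      exact: (Ng.1 q Dq).2.
    by apply: le_lt_trans cc'; have := ub g Ng; rewrite cE lee_fin.
  have := expR_gt0 (2 * c'); have := expR_gt0 (2 * r) => e1 e2.
  have : expR (2 * c') < expR (2 * r) by rewrite ltr_expR; lra.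
  move=> ee; have p1 : 0 < expR (2 * c') + 1 by lra.
  have p2 : 0 < expR (2 * r) + 1 by lra.
  by rewrite /tanhR ltr_pdivrMr // mulrAC ltr_pdivlMr //; lra.
have m1 : moebius_caratheodory D p q < 1 by apply: lt_trans h (tanhR_lt1 r).
have m0 := mc_ge0 p Dq.
apply: (@le_lt_trans _ _ (artanhR (moebius_caratheodory D p q))%:E); last first.
  by rewrite lte_fin artanhR_lt.
apply: ge_ereal_sup => _ [f fD <-]; rewrite lee_fin poincare_distE cabs_moebiusC.
pose g w := (f p - f w) / (1 - (f p)^* * f w).
have f1 z : D z -> cabs (f z) < 1 by move=> /fD [_]; rewrite norm_lt1.
have Ng : normalized_maps D p g.
  split; last by rewrite /g subrr mul0r.
  move=> z Dz; have [d0 dl] := moebius_lt1 (f1 _ Dp) (f1 _ Dz); split=> //.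
  have [dfz _] := fD z Dz.
  apply: (@derivableM _ _ (fun w => f p - f w) (fun w => (1 - (f p)^* * f w)^-1)).
    by apply: (@derivableB _ _ _ (fun=> f p) f); [exact: derivable_cst | exact: dfz].
  apply: (@derivableV _ _ (fun w => 1 - (f p)^* * f w)); first exact: d0.
  apply: (@derivableB _ _ _ (fun=> (1 : Cplx R)) (fun w => (f p)^* * f w)); first exact: derivable_cst.
  by apply: (@derivableM _ _ (fun=> (f p)^* ) f); [exact: derivable_cst | exact: dfz].
apply: artanhR_le => //; first exact: cabs_ge0.
exact: (mc_ub Dq Ng).
Qed.

End ball.

(** * Components of the complement in the sphere *)
Lemma infinite_set_injection (T : pointedType) (A : set T) : infinite_set A ->
  exists2 u : nat -> T, (forall n, A (u n)) & injective u.
Proof.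
move=> /infiniteP /pcard_leP [u]; exists u => [n|m n E]; first exact: funS.
by apply: (inj (f := u)); rewrite ?inE.
Qed.

Section sphere.
Context {R : realType}.
Implicit Types (U A : set (Cplx R)) (a b z : Cplx R).
Local Notation S := (riemann_sphere R).
Local Notation inS := (Some : Cplx R -> riemann_sphere R).
Local Notation comp U k := (connected_component (~` (inS @` U)) k).

Lemma Cplx_connected : connected [set: Cplx R].
Proof.
have -> : [set: Cplx R] =
   \bigcup_(h in [set: Cplx R]) [set 0 + cofr t * h | t in `[0, 1]%classic].
  rewrite eqEsubset; split=> // w _; exists w => //.
  by exists 1; rewrite /= ?in_itv /= ?ler01 ?lexx // /cofr rmorph1 mul1r add0r.
apply: bigcup_connected => [|h _]; last exact: csegment_connected.
exists 0 => h _; exists 0; first by rewrite /= in_itv /= lexx ler01.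
by rewrite /cofr rmorph0 mul0r addr0.
Qed.

Lemma connected_inS A : connected A -> connected (inS @` A).
Proof.
move=> cA; apply: connected_continuous_connected => //.
by apply: continuous_subspaceT; exact: one_point_compactification_some_continuous.
Qed.

Lemma component_absorbs U A (k : S) a b : connected A -> (forall z, A z -> ~ U z) ->
  A a -> A b -> comp U k (inS a) -> comp U k (inS b).
Proof.
move=> cA AU Aa Ab ka; apply: connected_component_trans ka _.
exists (inS @` A); last by exists b.
split; [by exists a | | exact: connected_inS].
by move=> _ [z Az <-] [z' Uz' [E]]; apply: (AU z Az); rewrite -E.
Qed.

Lemma component_absorbs_segment U (k : S) z w :
  (forall t : R, 0 <= t -> t <= 1 -> ~ U (z + cofr t * w)) ->
  comp U k (inS z) -> comp U k (inS (z + w)).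
Proof.
move=> zwU; apply: (@component_absorbs U [set z + cofr t * w | t in `[0, 1]%classic]).
- exact: csegment_connected.
- by move=> _ [t + <-]; rewrite /= in_itv /= => /andP [ta tb]; exact: zwU.
- by exists 0; rewrite /= ?in_itv /= ?lexx ?ler01 // /cofr rmorph0 mul0r addr0.
- by exists 1; rewrite /= ?in_itv /= ?lexx ?ler01 // /cofr rmorph1 mul1r.
Qed.

Lemma component_avoids U (k : S) z : comp U k (inS z) -> ~ U z.
Proof. by move=> /connected_component_sub h Uz; apply: h; exists z. Qed.

Lemma component_trace_closed U (k : S) : open U -> closed [set z | comp U k (inS z)].
Proof.
move=> oU; have cK : closed (comp U k).
  apply: component_closed; apply: open_closedC.
  exact: one_point_compactification_open_some.
apply: (@closed_comp _ _ inS); last exact: cK.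
by move=> z _; exact: one_point_compactification_some_continuous.
Qed.

(** The finite points of a component form a closed set.  If it avoided the closure
    of [U] it would also be open, hence the whole plane. *)
Lemma component_meets_boundary U (k : S) : open U -> U !=set0 ->
  (~` (inS @` U)) k -> ~ comp U k None ->
  exists2 x, comp U k (inS x) & closure U x.
Proof.
move=> oU [u Uu] Xk kN; apply: contrapT => nex.
have kk := connected_component_refl Xk.
have [a ka] : exists a, comp U k (inS a) by case: k Xk kN nex kk => // a; exists a.
have KT : [set z | comp U k (inS z)] = [set: Cplx R].
  apply: Cplx_connected; first by exists a.
    exists [set z | comp U k (inS z)]; last by rewrite setTI.
    apply/open_cabs => z kz.
    have : ~ closure U z by move=> cz; apply: nex; exists z.
    move=> /closure_cabs /existsNP [e /not_implyP [e0 eP]]; exists e => // w we.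
    apply: (@component_absorbs U [set v | cabs (v - z) < e] k z w) => //=.
    - exact: cball_connected.
    - by move=> v ve Uv; apply: eP; exists v.
    - by rewrite subrr cabs0.
  exists [set z | comp U k (inS z)]; last by rewrite setTI.
  exact: component_trace_closed.
have : [set z | comp U k (inS z)] u by rewrite KT.
by move=> /component_avoids.
Qed.

Lemma components_eq U (K1 K2 : set S) : components (~` (inS @` U)) K1 ->
  components (~` (inS @` U)) K2 -> (K1 `&` K2) !=set0 -> K1 = K2.
Proof.
move=> [k1 X1 <-] [k2 X2 <-] [z [h1 h2]].
by rewrite (same_connected_component h1) (same_connected_component h2).
Qed.

End sphere.

(** * Finiteness of the number of components *)

(** Here [U] is any nonempty relatively compact open set with [m < s] inside and [m = s] on
    the boundary; the constructions only use these values and the compact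
    family of functions dominated by [m]. *)
Section finiteness.
Context {R : realType} (D : set (Cplx R)) (p : Cplx R) (m : Cplx R -> R)
  (U : set (Cplx R)) (s : R).
Local Notation E := (dominated D p m).
Local Notation S := (riemann_sphere R).
Local Notation inS := (Some : Cplx R -> riemann_sphere R).
Local Notation comp k := (connected_component (~` (inS @` U)) k).
Hypotheses (oD : open D) (cD : connected D) (Dp : D p).
Hypothesis m1 : forall z, D z -> m z <= 1.
Hypothesis m_extremal : forall z, D z -> exists2 f, E f & cabs (f z) = m z.
Hypotheses (s0 : 0 < s) (oU : open U) (U0 : U !=set0).
Hypothesis mU : forall z, U z -> m z < s.
Hypothesis mbd : forall z, closure U z -> ~ U z -> m z = s.
Hypotheses (cptU : compact (closure U)) (clUD : closure U `<=` D).

Lemma superlevel_avoids f z : E f -> D z -> s <= cabs (f z) -> ~ U z.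
Proof.
move=> fE Dz sf Uz; have := mU Uz; apply/negP; rewrite -leNgt.
exact: le_trans sf (fE.1 z Dz).2.
Qed.

(** A dominated function vanishes at [p], so by the identity theorem it is nowhere
    locally equal to a nonzero constant. *)
Lemma dominated_order f z rho : E f -> 0 < rho ->
  (forall w, cabs (w - z) < 2 * rho -> D w) -> f z != 0 ->
  exists k c C, [/\ c != 0, 0 <= C & has_order f z rho k c C].
Proof.
move=> fE r0 rD fz0; have fh := dominated_holo_bounded m1 fE rD.
have Dz : D z by apply: rD; rewrite subrr cabs0 mulr_gt0.
have [h|//] := order_dichotomy r0 fh; exfalso.
have fD w : D w -> derivable f w 1 /\ cabs (f w) <= 1.
  by move=> Dw; split; [exact: (fE.1 w Dw).1 | exact: le_trans (fE.1 w Dw).2 (m1 Dw)].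
have := identity_theorem oD cD fD Dz Dp; rewrite fE.2 => /(_ _)/esym E0.
move/eqP: fz0; apply; apply: E0; exists (rho / 2); first by rewrite divr_gt0.
by move=> w /ltW /h.
Qed.

Lemma dominated_continuous f z : E f -> D z -> forall e : R, 0 < e ->
  exists2 d : R, 0 < d & forall w, cabs (w - z) < d -> cabs (f w - f z) < e.
Proof.
move=> fE Dz; have [l fl] := (derivable_cderiv _ _).1 (fE.1 z Dz).1.
exact: has_cderiv_continuous fl.
Qed.

(** Consider a maximum point of [|f|] on the part of the component in the closed
    disc.  If it were inside, [has_order_escape] would give a segment from it on
    which [|f| >= s], so that the segment stays in the component, and on which
    [|f|] exceeds the maximum. *)
Lemma component_reaches_circle f (k : S) x eps : E f -> 0 < eps ->
  (forall w, cabs (w - x) <= eps -> D w) -> comp k (inS x) -> s <= cabs (f x) ->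
  exists y, [/\ comp k (inS y), cabs (y - x) = eps & s <= cabs (f y)].
Proof.
move=> fE eps0 eD kx sx.
pose A := [set z | comp k (inS z)] `&` [set z | cabs (z - x) <= eps].
have cA : compact A.
  apply: (@subclosed_compact _ _ [set z | cabs (z - x) <= eps]).
  - by apply: closedI; [exact: component_trace_closed | exact: closed_cdisc].
  - exact: compact_cdisc.
  - by move=> z [].
have Ax : A x by split=> //=; rewrite subrr cabs0 ltW.
have [||z0 /set_mem [kz0 z0x] zmax] := @compact_EVT_max _ R (fun z => cabs (f z)) A _ cA.
- by exists x.
- apply: continuous_in_subspaceT => z /set_mem [_ /= zx].
  move=> B /nbhs_ballP [e /= e0 eB]; apply/nbhs_cabs.
  have [d d0 dP] := dominated_continuous fE (eD z zx) e0; exists d => // w /dP h /=.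
  apply: eB; rewrite /ball /=; apply: le_lt_trans h; apply/ler_normlP; split.
    by rewrite opprB; exact: cabsB.
  by rewrite cdistrC; exact: cabsB.
have {}kz0 : comp k (inS z0) := kz0.
have sz0 : s <= cabs (f z0) by apply: le_trans sx _; apply: zmax; exact: mem_set.
have [z0e|z0e] := eqVneq (cabs (z0 - x)) eps; first by exists z0.
exfalso; have {z0e}z0e : cabs (z0 - x) < eps by rewrite lt_neqAle z0e.
have [rho r0 rD] := open_disc oD (eD _ z0x).
have fz0 : f z0 != 0 by rewrite -cabs_gt0; apply: lt_le_trans sz0.
have [n [c [C [c0 C0 fo]]]] := dominated_order fE r0 rD fz0.
have [u [t0 t00 tP]] := has_order_escape r0 c0 C0 fo fz0.
have u1 : 0 < cabs u + 1 by rewrite ltr_wpDl ?cabs_ge0.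
pose t1 := Num.min (t0 / 2) ((eps - cabs (z0 - x)) / (cabs u + 1)).
have t10 : 0 < t1 by rewrite lt_min !divr_gt0 // subr_gt0.
have t1t0 : t1 < t0 by rewrite gt_min; apply/orP; left; lra.
have t1u : t1 * cabs u <= eps - cabs (z0 - x).
  have : t1 <= (eps - cabs (z0 - x)) / (cabs u + 1) by rewrite ge_min lexx orbT.
  by rewrite ler_pdivlMr // => h; apply: le_trans h; rewrite ler_pM2l // lerDl.
have inA t : 0 <= t -> t <= 1 -> cabs (z0 + cofr t * (cofr t1 * u) - x) <= eps.
  move=> ta tb; have -> : z0 + cofr t * (cofr t1 * u) - x =
    (z0 - x) + cofr t * (cofr t1 * u) by ring.
  apply: le_trans (cabsD _ _) _; rewrite !cabsM !cabs_cofr !ger0_norm // ?(ltW t10) //.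
  have : t * (t1 * cabs u) <= t1 * cabs u.
    by rewrite ler_piMl // mulr_ge0 ?cabs_ge0 // ltW.
  by lra.
have z1x : cabs (z0 + cofr t1 * u - x) <= eps.
  by have := inA 1 ler01 (lexx 1); rewrite [cofr 1]/cofr rmorph1 mul1r.
have kz1 : comp k (inS (z0 + cofr t1 * u)).
  apply: component_absorbs_segment kz0 => t ta tb.
  apply: (superlevel_avoids fE (eD _ (inA _ ta tb))).
  have [->|tn0] := eqVneq t 0; first by rewrite /cofr rmorph0 mul0r addr0.
  apply: le_trans sz0 _; rewrite mulrA -cofrM; apply/ltW/tP.
    by rewrite mulr_gt0 // lt_neqAle eq_sym tn0.
  by apply: le_lt_trans t1t0; rewrite ler_piMl // ltW.
have := zmax _ (mem_set (conj kz1 z1x : A _)).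
by apply/negP; rewrite -ltNge; exact: tP.
Qed.

(** When [d * v] is close to [f y1], the first-order part of [f (y1 + t v)] is
    nearly [(1 + t) * f y1], so [|f|] grows at rate at least [s / 2] for
    [t <= delta]; the gain [delta * s / 2] then pays for moving the end point
    from [y1 + delta v] to [y + delta v].  The end point
    [y + delta v] does not depend on [y1], so it is common to all components for
    which the estimates hold. *)
Lemma component_ascent f (k : S) y y1 d v rho delta : E f -> 0 < rho -> 0 < delta ->
  (forall w, cabs (w - y1) < 2 * rho -> D w) -> comp k (inS y1) -> s <= cabs (f y1) ->
  (forall z, cabs (z - y1) <= rho / 2 ->
     cabs (f z - f y1 - d * (z - y1)) <= 4 * (cabs (z - y1) / rho) ^+ 2) ->
  cabs (d * v - f y1) <= s / 4 ->
  delta * cabs v <= rho / 4 -> 4 * (cabs v / rho) ^+ 2 * delta <= s / 4 ->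
  cabs (y - y1) <= rho / 4 -> 8 / rho * cabs (y - y1) <= delta * s / 2 ->
  comp k (inS (y + cofr delta * v)).
Proof.
move=> fE r0 d0 rD ky sy fd dv dl1 dl2 yy1 yy2.
have seg t : 0 <= t -> t <= 1 ->
    s + t * delta * s / 2 <= cabs (f (y1 + cofr t * (cofr delta * v))) /\
    cabs (cofr t * (cofr delta * v)) <= rho / 4.
  move=> ta tb; have td0 : 0 <= t * delta by rewrite mulr_ge0 // ltW.
  have hE : cofr t * (cofr delta * v) = cofr (t * delta) * v by rewrite cofrM mulrA.
  have ha : cabs (cofr t * (cofr delta * v)) = t * (delta * cabs v).
    by rewrite hE cabsM cabs_cofr ger0_norm // mulrA.
  have ha4 : cabs (cofr t * (cofr delta * v)) <= rho / 4.
    rewrite ha; apply: le_trans dl1; rewrite ler_piMl // mulr_ge0 ?cabs_ge0 //; exact: ltW.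
  split=> //.
  have := fd (y1 + cofr t * (cofr delta * v)); rewrite [y1 + _]addrC addrK => /(_ _) fdt.
  have {}fdt := fdt (le_trans ha4 (_ : rho / 4 <= rho / 2)).
  have {}fdt := fdt ltac:(lra).
  rewrite [_ + y1]addrC in fdt *; set z := y1 + _ in fdt *.
  have q : 4 * (cabs (cofr t * (cofr delta * v)) / rho) ^+ 2 <= t * delta * (s / 4).
    rewrite ha; have -> : 4 * (t * (delta * cabs v) / rho) ^+ 2 =
      t * delta * (t * (4 * (cabs v / rho) ^+ 2 * delta)) by ring.
    rewrite ler_wpM2l //; apply: le_trans dl2; rewrite ler_piMl //.
    apply: mulr_ge0; last exact: ltW.
    by apply: mulr_ge0 => //; apply: exprn_ge0; apply: divr_ge0; [exact: cabs_ge0 | exact: ltW].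
  have lin : cabs (f y1 + d * (cofr t * (cofr delta * v))) >=
      (1 + t * delta) * cabs (f y1) - t * delta * (s / 4).
    have -> : f y1 + d * (cofr t * (cofr delta * v)) =
      (1 + cofr (t * delta)) * f y1 - cofr (t * delta) * (f y1 - d * v) by rewrite hE; ring.
    apply: le_trans (cabsB _ _).
    have -> : 1 + cofr (t * delta) = cofr (1 + t * delta) :> Cplx R.
      by rewrite cofrD /cofr rmorph1.
    rewrite !cabsM !cabs_cofr !ger0_norm // ?addr_ge0 //.
    by rewrite lerB // ler_wpM2l // cdistrC.
  have := cabsB (f y1 + d * (cofr t * (cofr delta * v)))
    (f y1 + d * (cofr t * (cofr delta * v)) - f z).
  rewrite opprD addrA subrr add0r opprK => tri.
  have tri2 : cabs (f y1 + d * (cofr t * (cofr delta * v)) - f z) <= t * delta * (s / 4).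
    apply: le_trans q; apply: le_trans fdt; rewrite -cabsN le_eqVlt; apply/orP; left.
    by apply/eqP; congr cabs; ring.
  have : (1 + t * delta) * s <= (1 + t * delta) * cabs (f y1).
    by rewrite ler_wpM2l // addr_ge0.
  lra.
have D1 t : 0 <= t -> t <= 1 -> D (y1 + cofr t * (cofr delta * v)).
  by move=> ta tb; apply: rD; rewrite addrC addKr; have := (seg t ta tb).2; lra.
pose w1 := y1 + cofr delta * v.
have kw1 : comp k (inS w1).
  apply: component_absorbs_segment ky => t ta tb.
  apply: (superlevel_avoids fE (D1 t ta tb)); apply: le_trans (seg t ta tb).1.
  by rewrite lerDl !mulr_ge0 ?invr_ge0 // ltW.
have [sw1 aw1] := seg 1 ler01 (lexx 1).
rewrite [cofr 1]/cofr rmorph1 !mul1r -/w1 in sw1 aw1.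
have rD2 w : cabs (w - w1) < 2 * (rho / 2) -> D w.
  move=> ww1; apply: rD; apply: le_lt_trans (cabs_tri w1 _ _) _.
  by rewrite [w1 - y1]addrC addKr; lra.
have [_ _ lip] := dominated_first_order m1 fE (divr_gt0 r0 (ltr0n R 2)) rD2.
have -> : y + cofr delta * v = w1 + (y - y1) by rewrite /w1; ring.
apply: component_absorbs_segment kw1 => t ta tb.
set P := w1 + _.
have Pw : cabs (P - w1) <= cabs (y - y1).
  by rewrite /P [w1 + _]addrC addrK cabsM cabs_cofr ger0_norm // ler_piMl ?cabs_ge0.
apply: (superlevel_avoids fE); first by apply: rD2; lra.
have := lip P; have -> : rho / 2 / 2 = rho / 4 by field.
move=> /(_ (le_trans Pw yy1)).
have -> : 4 / (rho / 2) = 8 / rho by field; rewrite gt_eqF.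
have : 8 / rho * cabs (P - w1) <= 8 / rho * cabs (y - y1).
  by rewrite ler_wpM2l // divr_ge0 // ltW.
have := cabsB (f w1) (f w1 - f P); rewrite opprB addrCA subrr addr0 cdistrC.
lra.
Qed.

(** The equicontinuity of dominated functions allows the argument to vary. *)
Lemma ulim_eval (T : Type) (F : set_system T) (UF : UltraFilter F)
    (f_ : T -> Cplx R -> Cplx R) f (x_ : T -> Cplx R) x :
  (forall j, E (f_ j)) -> (forall z, D z -> ulim F (fun j => f_ j z) (f z)) ->
  D x -> ulim F x_ x -> ulim F (fun j => f_ j (x_ j)) (f x).
Proof.
move=> fE fl Dx xl e e0; have [rho r0 rD] := open_disc oD Dx.
have h0 : 0 < Num.min (rho / 2) (e * rho / 8) by rewrite lt_min !divr_gt0 // mulr_gt0.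
have e2 : 0 < e / 2 by rewrite divr_gt0.
apply: filterS2 (xl _ h0) (fl x Dx _ e2) => j /=; rewrite lt_min => /andP [xj1 xj2] h.
have [_ _ lip] := dominated_first_order m1 (fE j) r0 rD.
apply: le_lt_trans (cabs_tri (f_ j x) _ _) _; rewrite (splitr e).
apply: ler_ltD => //; apply: le_trans (lip _ (ltW xj1)) _.
by rewrite mulrAC ler_pdivrMr //; lra.
Qed.

(** The limit [f] of the extremal functions is chosen first; it determines a circle
    free of critical points of [f], and only then are the points [y_j] chosen near
    that circle. *)
Theorem no_component_sequence (k_ : nat -> S) :
  (forall j, (~` (inS @` U)) (k_ j)) -> (forall j, ~ comp (k_ j) None) ->
  (forall i j, comp (k_ i) = comp (k_ j) -> i = j) -> False.
Proof.
move=> kX kN kinj.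
have bp j : exists x, comp (k_ j) (inS x) /\ closure U x.
  by have [x h1 h2] := component_meets_boundary oU U0 (kX j) (kN j); exists x.
have [x_ x_P] := choice bp.
have mx j : m (x_ j) = s.
  by apply: mbd; [exact: (x_P j).2 | exact: component_avoids (x_P j).1].
have ex j : exists f, E f /\ cabs (f (x_ j)) = s.
  by have [f fE fx] := m_extremal (clUD (x_P j).2); exists f; rewrite fx mx.
have [f_ f_P] := choice ex.
have fE j : E (f_ j) := (f_P j).1.
have [F [UF nF]] := @ultraFilterLemma nat \oo _.
have [f Ef fl] := dominated_compact oD Dp m1 UF fE.
have [x clx xl] : exists2 x, closure U x & ulim F x_ x.
  by apply: (ulim_compact cptU); apply: filterE => j; exact: (x_P j).2.
have Dx := clUD clx.
have fx : s <= cabs (f x).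
  apply: (ulim_ge (ulim_eval UF fE fl Dx xl)).
  by apply: filterE => j /=; rewrite (f_P j).2.
have [rho r0 rD] := open_disc oD Dx.
have fx0 : f x != 0 by rewrite -cabs_gt0; apply: lt_le_trans fx.
have fh := dominated_holo_bounded m1 Ef rD.
have [n [c [C [c0 C0 fo]]]] := dominated_order Ef r0 rD fx0.
have [eta eta0 etaP] := isolated_critical r0 fh c0 C0 fo.
pose eps := Num.min eta (rho / 2).
have eps0 : 0 < eps by rewrite lt_min eta0 divr_gt0.
have eps_eta : eps <= eta by rewrite ge_min lexx.
have eps_rho : eps <= rho / 2 by rewrite ge_min lexx orbT.
have xnear : F [set j | cabs (x_ j - x) < rho / 2] by apply: xl; rewrite divr_gt0.
have yex j : exists y, cabs (x_ j - x) < rho / 2 ->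
    [/\ comp (k_ j) (inS y), cabs (y - x_ j) = eps & s <= cabs (f_ j y)].
  have [xj|nxj] := pselect (cabs (x_ j - x) < rho / 2); last by exists 0.
  have wD w : cabs (w - x_ j) <= eps -> D w.
    move=> wx; apply: rD; apply: le_lt_trans (cabs_tri (x_ j) _ _) _; lra.
  have sx : s <= cabs (f_ j (x_ j)) by rewrite (f_P j).2.
  have [y yP] := component_reaches_circle (fE j) eps0 wD (x_P j).1 sx.
  by exists y.
have [y_ y_P] := choice yex.
have [y yl] : exists y, ulim F y_ y.
  apply: (@ulim_exists _ _ F UF y_ (eps + (rho / 2 + cabs x))).
  apply: filterS xnear => j /= xj; have [_ yj _] := y_P j xj.
  have -> : y_ j = (y_ j - x_ j) + ((x_ j - x) + x) by ring.
  apply: le_trans (cabsD _ _) _; apply: lerD; first by rewrite yj.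
  by apply: le_trans (cabsD _ _) _; rewrite lerD2r ltW.
have yx : cabs (y - x) = eps.
  apply/eqP; rewrite eq_le; apply/andP; split.
    apply: (ulim_le (ulimB yl xl)); apply: filterS xnear => j /= xj.
    by have [_ -> _] := y_P j xj.
  apply: (ulim_ge (ulimB yl xl)); apply: filterS xnear => j /= xj.
  by have [_ -> _] := y_P j xj.
have Dy : D y by apply: rD; rewrite yx; lra.
have fyl := ulim_eval UF fE fl Dy yl.
have fy : s <= cabs (f y).
  by apply: (ulim_ge fyl); apply: filterS xnear => j /= xj; have [_ _] := y_P j xj.
pose rho1 := rho / 2; have r10 : 0 < rho1 by rewrite divr_gt0.
have E1 : 2 * rho1 = rho by rewrite /rho1; field.
have rD1 j : cabs (x_ j - x) < rho / 2 -> forall w, cabs (w - y_ j) < 2 * rho1 -> D w.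
  move=> xj w; rewrite E1 => wy; have [_ yj _] := y_P j xj.
  apply: rD; apply: le_lt_trans (cabs_tri (y_ j) _ _) _.
  have := cabs_tri (x_ j) (y_ j) x; rewrite yj; lra.
have dex j : exists d, cabs (x_ j - x) < rho / 2 -> cabs d <= 6 / rho1 /\
    forall z, cabs (z - y_ j) <= rho1 / 2 ->
      cabs (f_ j z - f_ j (y_ j) - d * (z - y_ j)) <= 4 * (cabs (z - y_ j) / rho1) ^+ 2.
  have [xj|nxj] := pselect (cabs (x_ j - x) < rho / 2); last by exists 0.
  have [d [_ h1 h2] _] := dominated_first_order m1 (fE j) r10 (rD1 j xj).
  by exists d.
have [d_ d_P] := choice dex.
have [|d dl] := @ulim_exists _ _ F UF d_ (6 / rho1).
  by apply: filterS xnear => j /= xj; exact: (d_P j xj).1.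
(* The limit of the derivatives of the [f_j] at [y_j] is the derivative of [f] at [y]. *)
have fd : has_cderiv f y d.
  apply: (@has_cderiv_quadratic _ f y d (rho1 / 2) (4 / rho1 ^+ 2)).
  - by rewrite divr_gt0.
  - by rewrite divr_ge0 // exprn_ge0 // ltW.
  move=> z zy; have Dz : D z.
    apply: rD; apply: le_lt_trans (cabs_tri y _ _) _; rewrite yx; lra.
  have zl : ulim F (fun j => y_ j + (z - y)) z.
    move=> e e0; apply: filterS (yl e e0) => j /=.
    by have -> : y_ j + (z - y) - z = y_ j - y by ring.
  have -> : 4 / rho1 ^+ 2 * cabs (z - y) ^+ 2 = 4 * (cabs (z - y) / rho1) ^+ 2.
    by rewrite [in RHS]expr_div_n [RHS]mulrA [LHS]mulrAC.
  apply: (ulim_le (ulimB (ulimB (ulim_eval UF fE fl Dz zl) fyl) (ulimM (z - y) dl))).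
  apply: filterS xnear => j /= xj; have := (d_P j xj).2 (y_ j + (z - y)).
  by rewrite [y_ j + _]addrC addrK; apply.
have d0 : d != 0 by apply: etaP fd; rewrite yx.
pose v := f y / d.
have dv : ulim F (fun j => d_ j * v - f_ j (y_ j)) 0.
  have := ulimB (ulimM v dl) fyl; rewrite /v mulrCA mulfV // mulr1 subrr; exact.
have v0 := cabs_ge0 v.
pose C1 := 4 * (cabs v / rho1) ^+ 2.
have C10 : 0 <= C1 by rewrite mulr_ge0 // sqr_ge0.
pose delta := Num.min (rho1 / 4 / (cabs v + 1)) (s / 4 / (C1 + 1)).
have vp : 0 < cabs v + 1 by lra.
have Cp : 0 < C1 + 1 by lra.
have delta0 : 0 < delta by rewrite lt_min; apply/andP; split; rewrite !divr_gt0.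
have dl1 : delta * cabs v <= rho1 / 4.
  have : delta <= rho1 / 4 / (cabs v + 1) by rewrite ge_min lexx.
  by rewrite ler_pdivlMr //; nra.
have dl2 : C1 * delta <= s / 4.
  have : delta <= s / 4 / (C1 + 1) by rewrite ge_min lexx orbT.
  by rewrite ler_pdivlMr //; nra.
pose tau := Num.min (rho1 / 4) (delta * s / 2 / (8 / rho1)).
have q0 : 0 < 8 / rho1 by rewrite divr_gt0.
have tau0 : 0 < tau by rewrite lt_min; apply/andP; split; rewrite !divr_gt0 // mulr_gt0.
have s4 : 0 < s / 4 by rewrite divr_gt0.
have all_j : F [set j | comp (k_ j) (inS (y + cofr delta * v))].
  apply: filterS3 xnear (yl _ tau0) (dv _ s4) => j /= xj; rewrite subr0 lt_min.
  move=> /andP [yj1 yj2] dvj; have [ky _ sy] := y_P j xj.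
  apply: (component_ascent (fE j) r10 delta0 (rD1 j xj) ky sy (d_P j xj).2) => //.
  - exact: ltW.
  - by rewrite cdistrC ltW.
  - by move: yj2; rewrite ltr_pdivlMr // cdistrC mulrC => /ltW.
have [i ki] := filter_ex all_j.
have Fi : F [set j | (i < j)%N] by apply: nF; exists i.+1.
have [j [kj /= ij]] := filter_ex (filterI all_j Fi).
suff : i = j by move=> e; rewrite e ltnn in ij.
by apply: kinj; rewrite (same_connected_component ki) (same_connected_component kj).
Qed.

(** At most one component contains the point at infinity, so infinitely many
    components would leave infinitely many that avoid it. *)
Theorem finite_complement_components : finite_set (components (~` (inS @` U))).
Proof.
apply: contrapT => inf.
have fN : finite_set [set K | components (~` (inS @` U)) K /\ K None].
  have [[K0 [cK0 K0N]]|nK] := pselect (exists K, components (~` (inS @` U)) K /\ K None).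
    apply: (@sub_finite_set _ _ [set K0]); last exact: finite_set1.
    move=> K [cK KN] /=; apply: components_eq cK cK0 _; by exists None.
  rewrite (_ : [set K | _] = set0); first exact: finite_set0.
  by rewrite -subset0 => K KP; apply: nK; exists K.
have [K_ K_P K_inj] := infinite_set_injection (infinite_setD inf fN).
have kex j : exists k, (~` (inS @` U)) k /\ comp k = K_ j.
  by have [[k Xk kE] _] := K_P j; exists k.
have [k_ k_P] := choice kex.
apply: (@no_component_sequence k_).
- by move=> j; exact: (k_P j).1.
- move=> j; have [cK nK] := K_P j; rewrite (k_P j).2 => KN; exact: nK.
- by move=> i j; rewrite (k_P i).2 (k_P j).2; exact: K_inj.
Qed.

End finiteness.

(** * Components of Caratheodory balls *)
Section ball_components.
Context {R : realType} (D : set (Cplx R)) (p : Cplx R) (r : R).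
Hypotheses (oD : open D) (Dp : D p).
Local Notation B := (caratheodory_ball D p r).
Local Notation mc := (moebius_caratheodory D p).

Lemma caratheodory_ball_open : open B.
Proof.
apply/open_cabs => q /(caratheodory_ballE _ _ oD Dp) [Dq qs].
have [rho r0 rD] := open_disc oD Dq.
have q0 : 0 < tanhR r - mc q by rewrite subr_gt0.
exists (Num.min (rho / 2) ((tanhR r - mc q) * rho / 4)).
  by rewrite lt_min !divr_gt0 // mulr_gt0.
move=> w; rewrite lt_min => /andP [w1 w2]; apply/(caratheodory_ballE _ _ oD Dp).
split; first by apply: rD; lra.
have /ler_normlP [_ h] := mc_lipschitz p r0 rD (ltW w1).
have : 4 / rho * cabs (w - q) < tanhR r - mc q.
  rewrite mulrAC ltr_pdivrMr //; lra.
lra.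
Qed.

Lemma component_absorbs_disc U y (e : R) : components B U ->
  (forall w, cabs (w - y) < e -> B w) -> (exists2 w, U w & cabs (w - y) < e) ->
  forall w, cabs (w - y) < e -> U w.
Proof.
move=> [x Bx <-] eB [w Uw wy] w' w'y.
apply: connected_component_trans Uw _; exists [set v | cabs (v - y) < e] => //.
by split=> //; exact: cball_connected.
Qed.

Lemma component_open U : components B U -> open U.
Proof.
move=> cU; apply/open_cabs => y Uy.
have By : B y by have [x _ UE] := cU; move: Uy; rewrite -UE; exact: connected_component_sub.
have [e e0 eB] := (open_cabs _).1 caratheodory_ball_open y By.
exists e => //; apply: component_absorbs_disc cU eB _.
by exists y => //; rewrite subrr cabs0.
Qed.

(** By continuity [m] is at most [tanh r] at [x].  If it were less, a disc about
    [x] would lie in the ball and meet [U], so [x] would belong to [U]. *)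
Lemma component_boundary_value U x : components B U -> D x ->
  closure U x -> ~ U x -> mc x = tanhR r.
Proof.
move=> cU Dx /closure_cabs clx nUx; apply/eqP; rewrite eq_le; apply/andP; split.
  have [rho r0 rD] := open_disc oD Dx.
  apply/ler_addgt0Pr => e e0.
  have h0 : 0 < Num.min (rho / 2) (e * rho / 4) by rewrite lt_min !divr_gt0 // mulr_gt0.
  have [w Uw] := clx _ h0; rewrite lt_min => /andP [w1 w2].
  have /(caratheodory_ballE _ _ oD Dp) [Dw ws] : B w.
    by have [x0 _ UE] := cU; move: Uw; rewrite -UE; exact: connected_component_sub.
  have /ler_normlP [h _] := mc_lipschitz p r0 rD (ltW w1).
  have : 4 / rho * cabs (w - x) <= e by rewrite mulrAC ler_pdivrMr //; lra.
  lra.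
rewrite leNgt; apply/negP => xs; apply: nUx.
have Bx : B x by apply/(caratheodory_ballE _ _ oD Dp).
have [e e0 eB] := (open_cabs _).1 caratheodory_ball_open x Bx.
by apply: (component_absorbs_disc cU eB (clx e e0)); rewrite subrr cabs0.
Qed.

End ball_components.

Theorem theorem5 (R : realType) (D : set (Cplx R)) (p : Cplx R) (r : R) :
  is_domain D -> C_hyperbolic D -> D p -> 0 < r ->
  forall U : set (Cplx R), components (caratheodory_ball D p r) U ->
    relatively_compact_in D U ->
    is_domain U /\ finitely_connected U.
Proof.
move=> [oD cD _] _ Dp r0 U cU [cptU clUD].
have UB : U `<=` caratheodory_ball D p r.
  by have [x _ <-] := cU; exact: connected_component_sub.
have oU := component_open oD Dp cU.
have [x0 Bx0 UE] := cU.
have U0 : U !=set0 by exists x0; rewrite -UE; exact: connected_component_refl.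
split; first by split=> //; rewrite -UE; exact: component_connected.
have [[|n] nE] : finite_set (components (~` ((Some : Cplx R -> riemann_sphere R) @` U))).
- apply: (@finite_complement_components _ D p (moebius_caratheodory D p) U (tanhR r)) => //.
  + exact: mc_le1.
  + exact: mc_extremal.
  + exact: tanhR_gt0.
  + by move=> z /UB /(caratheodory_ballE _ _ oD Dp) [].
  + by move=> z clz nUz; apply: (component_boundary_value oD Dp cU) => //; exact: clUD.
- move: nE; rewrite II0 card_eq0 => /eqP E0.
  have : components (~` ((Some : Cplx R -> riemann_sphere R) @` U))
     (connected_component (~` ((Some : Cplx R -> riemann_sphere R) @` U)) None).
    by exists None => // -[].
  by rewrite E0.
- by exists n.
Qed.
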